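(* Let $1<Q<+\infty$ and $Q<p<+\infty$. Suppose that $(X,d,\mu)$ is a complete, unbounded metric measure space with metric $d$ and Ahlfors $Q$-regular measure $\mu$ supporting a $p$-Poincaré inequality, and suppose that $X$ satisfies the annular chain property. Then for every function $u\in\dot N^{1,p}(X)$, $$\lim_{x\to+\infty}\frac{|u(x)|}{|x|^{1-Q/p}}=0,$$ and also $$\lim_{x\to+\infty}\frac{|u_{B(x,1)}|}{|x|^{1-Q/p}}=0,$$ where $u_{B(x,1)}:=\frac1{\mu(B(x,1))}\int_{B(x,1)}u\,d\mu$.
   Context: A metric measure space $(X,d,\mu)$ is a separable metric space $(X,d)$ with a nontrivial locally finite Borel-regular measure $\mu$. $B(x,r)$ is the ball of center $x$ and radius $r$. $\mu$ is Ahlfors $Q$-regular if there is a constant $C_Q\ge1$ with $r^Q/C_Q\le\mu(B(x,r))\le C_Qr^Q$ for all $x\in X$, $r>0$. Upper gradient: a Borel function $\rho:X\to[0,+\infty]$ is an upper gradient of a locally integrable function $u$ if $|u(x)-u(y)|\le\int_\gamma\rho\,ds$ for every rectifiable curve $\gamma$ connecting $x$ and $y$ (for all $x,y\in X$). $\dot N^{1,p}(X)$ is the collection of all locally integrable functions on $X$ (defined pointwise everywhere) that have a $p$-integrable upper gradient on $X$. $p$-Poincaré inequality: every ball has finite positive measure and there are finite constants $C>0$, $\lambda\ge1$ such that $\frac1{\mu(B(x,r))}\int_{B(x,r)}|u-u_{B(x,r)}|\,d\mu\le Cr\left(\frac1{\mu(B(x,\lambda r))}\int_{B(x,\lambda r)}\rho^p\,d\mu\right)^{1/p}$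 for all balls $B(x,r)$ and all pairs $(u,\rho)$ with $u$ integrable on balls and $\rho$ an upper gradient of $u$. A base point $O\in X$ is fixed, $|x|:=d(O,x)$, and $x\to+\infty$ means $|x|\to+\infty$. Annular chain property: for $\lambda\ge1$, $X$ satisfies an annular $\lambda$-chain condition at $O$ if there are finite constants $c_1\ge1$, $c_2\ge1$, $\delta>0$ and $M<+\infty$ so that given $r>0$ and points $x,y\in B(O,r)\setminus B(O,r/2)$ one can find balls $B_1,\dots,B_k$ with: (1) $k\le M$; (2) $B_1=B(x,r/(\lambda c_1))$, $B_k=B(y,r/(\lambda c_1))$, and the radius of each $B_i$ is $r/(\lambda c_1)$ for $1\le i\le k$; (3) $B_i\subset B(O,c_2r)\setminus B(O,r/c_2)$ for $1\le i\le k$; (4) for each $1\le i\le k-1$ there is a ball $D_i\subset B_i\cap B_{i+1}$ with radius $\delta r$. $X$ has the annular chain property if it satisfies an annular $\lambda$-chain condition at $O$ for every $\lambda\ge1$. *)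

(* Defs.v *)
From HB Require Import structures.
From mathcomp Require Import all_boot all_order all_algebra.
From mathcomp Require Import all_classical all_reals all_analysis.
From mathcomp Require Import measurable_realfun.

Set Implicit Arguments.
Unset Strict Implicit.
Unset Printing Implicit Defensive.

Import Order.TTheory GRing.Theory Num.Theory.
Import numFieldNormedType.Exports.

Local Open Scope classical_set_scope.
Local Open Scope ring_scope.

(* The measurable structures of the library require a pointed carrier; the
   point only records that the space is nonempty. *)
#[short(type="pmetricType")]
HB.structure Definition PMetric (K : numDomainType) :=
  {M of Metric K M & isPointed M}.

#[short(type="completePMetricType")]
HB.structure Definition CompletePMetric (K : numDomainType) :=
  {M of PMetric K M & Complete M}.

Section metric.
Context {R : realType}.

Definition separable_space (X : topologicalType) :=
  exists2 D : set X, countable D & dense D.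

Definition unbounded_space (X : metricType R) :=
  forall M : R, exists x y : X, M < mdist x y.

(* Neighborhoods of infinity: the filter of "|x| -> +oo", where |x| = d(O, x). *)
Definition at_infinity (X : metricType R) (O : X) : set_system X :=
  [set A | exists M : R, forall x, M < mdist O x -> A x].

#[global] Instance at_infinity_filter (X : metricType R) (O : X) :
  Filter (at_infinity O).
Proof.
split=> [|A B [M HA] [N HB]|A B AB [M HA]].
- by exists 0.
- exists (Num.max M N) => x; rewrite gt_max => /andP[Mx Nx].
  by split; [exact: HA|exact: HB].
- by exists M => x /HA /AB.
Qed.

(* The i-th ball of the chain is ball (z i) (r / (lam * c1)), 1 <= i <= k. *)
Definition annular_chain_condition (X : metricType R) (O : X) (lam : R) :=
  exists c1 c2 delta : R, exists M : nat,
    [/\ 1 <= c1, 1 <= c2, 0 < delta &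
      forall (r : R) (x y : X), 0 < r ->
        (ball O r `\` ball O (r / 2)) x -> (ball O r `\` ball O (r / 2)) y ->
        exists (k : nat) (z : nat -> X),
          [/\ (1 <= k <= M)%N,
              z 1%N = x,
              z k = y,
              forall i, (1 <= i <= k)%N ->
                ball (z i) (r / (lam * c1)) `<=`
                  ball O (c2 * r) `\` ball O (r / c2) &
              forall i, (1 <= i <= k.-1)%N ->
                exists w : X, ball w (delta * r) `<=`
                  ball (z i) (r / (lam * c1)) `&`
                  ball (z i.+1) (r / (lam * c1))]].

Definition annular_chain_property (X : metricType R) (O : X) :=
  forall lam : R, 1 <= lam -> annular_chain_condition O lam.

End metric.

Section curves.
Context {R : realType} {X : metricType R}.
Implicit Types (gamma : R -> X) (a b : R).

Definition polygonal_length gamma a b (s : seq R) : R :=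
  let F := gamma \o nth b (a :: s) in
  \sum_(0 <= n < size s) mdist (F n) (F n.+1).

Definition curve_length gamma a b : \bar R :=
  ereal_sup [set (polygonal_length gamma a b s)%:E | s in itv_partition a b].

Definition rectifiable_curve gamma a b :=
  [/\ a <= b, {within `[a, b], continuous gamma} &
      (curve_length gamma a b < +oo)%E].

(* Arc-length parametrization, on [0, length]. The point of the curve at
   arc length s does not depend on the parameter t that is chosen. *)
Definition arclength_param gamma a b (s : R) : X :=
  gamma (xget a [set t | a <= t <= b /\ curve_length gamma a t = s%:E]).

Definition line_integral gamma a b (rho : X -> \bar R) : \bar R :=
  (\int[lebesgue_measure]_(s in `[0%R, fine (curve_length gamma a b)])
      rho (arclength_param gamma a b s))%E.

End curves.

Section metric_measure.
Context {R : realType} {X : pmetricType R}.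
Implicit Types (mu : {outer_measure set X -> \bar R}) (u : X -> R)
  (rho : X -> \bar R).

Definition upper_gradient rho u :=
  [/\ measurable_fun [set: g_sigma_algebraType (@open X)]
        (rho : g_sigma_algebraType (@open X) -> \bar R),
      forall x, (0 <= rho x)%E &
      forall (a b : R) (gamma : R -> X), rectifiable_curve gamma a b ->
        (`|u (gamma a) - u (gamma b)|%:E <= line_integral gamma a b rho)%E].

(* mu is a measure on all subsets in the sense of geometric measure theory,
   i.e., an outer measure; integrals are taken with respect to its
   restriction to the Caratheodory measurable sets. *)
Definition cara mu : {measure set (caratheodory_type mu) -> \bar R} := mu.

Definition borel_regular mu :=
  <<s @open X >> `<=` mu.-caratheodory /\
  forall A : set X, exists B : set X,
    [/\ <<s @open X >> B, A `<=` B & mu B = mu A].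

Definition locally_finite mu :=
  forall x : X, exists2 r : R, 0 < r & (mu (ball x r) < +oo)%E.

Definition metric_measure_space mu :=
  [/\ separable_space X, borel_regular mu, locally_finite mu &
      mu [set: X] != 0%E].

Definition ahlfors_regular (Q : R) mu :=
  exists2 C : R, 1 <= C &
    forall (x : X) (r : R), 0 < r ->
      ((r `^ Q / C)%:E <= mu (ball x r) <= (C * r `^ Q)%:E)%E.

Definition mean mu (A : set X) u : R :=
  (fine (mu A))^-1 * \int[cara mu]_(x in A) u x.

Definition locally_integrable_fun mu u :=
  forall x : X, exists2 r : R, 0 < r &
    (cara mu).-integrable (ball x r) (EFin \o u).

Definition integrable_on_balls mu u :=
  forall (x : X) (r : R), 0 < r ->
    (cara mu).-integrable (ball x r) (EFin \o u).

Definition dotN1p (p : R) mu u :=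
  locally_integrable_fun mu u /\
  exists2 rho, upper_gradient rho u & (\int[cara mu]_x (rho x `^ p) < +oo)%E.

Definition poincare_inequality (p : R) mu :=
  (forall (x : X) (r : R), 0 < r -> (0 < mu (ball x r) < +oo)%E) /\
  exists C lam : R,
    [/\ 0 < C, 1 <= lam &
      forall u rho, integrable_on_balls mu u -> upper_gradient rho u ->
      forall (x : X) (r : R), 0 < r ->
        (((fine (mu (ball x r)))^-1)%:E *
           \int[cara mu]_(y in ball x r) `|u y - mean mu (ball x r) u|%:E <=
         (C * r)%:E *
           (((fine (mu (ball x (lam * r))))^-1)%:E *
              \int[cara mu]_(y in ball x (lam * r)) (rho y `^ p)) `^ p^-1)%E].

End metric_measure.

(* Main.v *)
(** Poincare's inequality and telescoping over shrinking balls give Morrey's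
    estimate [|w x - w y| <= C d(x, y)^a N], with [a = 1 - Q/p], for continuous [w]
    having an upper gradient of L^p norm at most [N]. Applied to the minimal cost of
    discrete chains issued from [x], the cost being measured by lower envelopes of a
    lower semicontinuous majorant of [rho] (Vitali-Caratheodory), it yields chains
    from [x] to [y] of small cost and bounded length. Closed balls being compact, the
    chains accumulate on a Lipschitz curve from [x] to [y] along which [rho] has
    integral at most [C d(x, y)^a N]. Working with curves makes every estimate valid
    at every point: in particular [u] is Hoelder continuous.

    For the decay, let [rho] be replaced by zero on a ball [B(O, r)] outside of which
    its L^p norm is at most [e]. A curve from a distant [x] to [O] which is nearly
    optimal for this smaller weight, stopped when it first meets the closed ball of
    radius [r], gives [|u x| <= M + C e |x|^a], where [M] bounds [|u|] on that closed
    ball. *)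

Require Import Defs.
From HB Require Import structures.
From mathcomp Require Import all_boot all_order all_algebra.
From mathcomp Require Import all_classical all_reals all_analysis.
From mathcomp Require Import measurable_realfun.
From mathcomp Require Import ring lra.

Set Implicit Arguments.
Unset Strict Implicit.
Unset Printing Implicit Defensive.

Import Order.TTheory GRing.Theory Num.Theory.
Import numFieldNormedType.Exports.

Local Open Scope classical_set_scope.
Local Open Scope ring_scope.

(** * Length and arc-length parametrization of curves *)

Section CurveLength.
Context {R : realType} {X : metricType R}.
Variable gamma : R -> X.
Implicit Types (a b c s t : R) (l : seq R).

(** Telescoping of means recovers the value of a function only where it is continuous, and [u] is
    not assumed continuous, so Morrey's estimate cannot be applied to [u] directly. The minimal
    chain cost can take its place: truncated envelopes make it continuous, a cap makes it bounded,
    and it has one and the same upper gradient at every scale, so the estimate survives refinement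
    of the chains. Lower semicontinuity of the majorant is what makes its envelopes increase back to
    it in the limit.

    The majorant is moreover kept above a constant [c] on a ball of radius [K] about [x]: without a
    positive lower bound a cheap chain could be arbitrarily long, and no Lipschitz limit would
    exist. This adds about [c^p K^Q] to the integral of the p-th power. Since Q < p, a radius [K]
    comparable to d(x, y) is enough for cheap chains to stay in the ball while the L^p norm grows
    only by a constant factor.

    In the decay argument the cut-off weight is in general not an upper gradient of [u]; it only has
    to agree with [rho] along the stopped curve. *)

Fixpoint plen a l : R :=
  if l is y :: l' then mdist (gamma a) (gamma y) + plen y l' else 0.

Lemma polygonal_lengthE a b l : polygonal_length gamma a b l = plen a l.
Proof.
elim: l a => [|y l ih] a; first by rewrite /polygonal_length big_geq.
by rewrite /polygonal_length /= big_nat_recl//= -ih.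
Qed.

Lemma plen_rcons a l b :
  plen a (rcons l b) = plen a l + mdist (gamma (last a l)) (gamma b).
Proof. by elim: l a => [|y l ih] a /=; rewrite ?addr0 ?add0r// ih addrA. Qed.

Lemma plen_cat a l l' : plen a (l ++ l') = plen a l + plen (last a l) l'.
Proof. by elim: l a => [|y l ih] a /=; rewrite ?add0r// ih addrA. Qed.

Lemma plen_le_length a b l : itv_partition a b l ->
  ((plen a l)%:E <= curve_length gamma a b)%E.
Proof.
move=> abl; apply: ereal_sup_ubound; exists l => //.
by rewrite polygonal_lengthE.
Qed.

Lemma length_le a b M : (forall l, itv_partition a b l -> ((plen a l)%:E <= M)%E) ->
  (curve_length gamma a b <= M)%E.
Proof.
move=> h; apply: ge_ereal_sup => _ [l abl <-].
by rewrite polygonal_lengthE; exact: h.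
Qed.

Lemma length_ge_dist a b : a <= b ->
  ((mdist (gamma a) (gamma b))%:E <= curve_length gamma a b)%E.
Proof.
rewrite le_eqVlt => /predU1P[<-|ab].
  by rewrite mdistxx; apply: (@plen_le_length a a [::]).
by have := plen_le_length (itv_partition1 ab); rewrite /= addr0.
Qed.

Lemma length_ge0 a b : a <= b -> (0 <= curve_length gamma a b)%E.
Proof. by move=> /length_ge_dist; apply: le_trans; rewrite lee_fin mdist_ge0. Qed.

Lemma length_xx a : curve_length gamma a a = 0%E.
Proof.
apply/eqP; rewrite eq_le length_ge0// andbT.
by apply: length_le => l /itv_partitionxx ->.
Qed.

Lemma itv_partition_split a c b l : a <= c -> c <= b -> itv_partition a b l ->
  exists l1 l2, [/\ itv_partition a c l1, itv_partition c b l2 &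
    plen a l <= plen a l1 + plen c l2].
Proof.
elim: l a => [|y l ih] a ac cb abl.
  have ab := itv_partition_nil abl.
  have {}ac : a = c by apply/eqP; rewrite eq_le ac ab cb.
  by exists [::], [::]; rewrite -ab -ac /= addr0; split.
have := abl; rewrite /itv_partition /= => -[/andP[ay yl] lb].
case: (leP y c) => [yc|cy].
  have [l1 [l2 [p1 p2 h]]] := ih y yc cb (itv_partition_cons abl).
  exists (y :: l1), l2; split => //.
    by move: p1; rewrite /itv_partition /= ay => -[-> ->].
  by rewrite /= -addrA lerD2l.
(* Partitions are strictly increasing, so [c] can be inserted before [y] only if it differs from
   [a]. *)
move: ac; rewrite le_eqVlt => /predU1P[<-|ac].
  by exists [::], (y :: l); split; rewrite ?add0r.
exists [:: c], (y :: l); split.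
- exact: itv_partition1.
- by rewrite /itv_partition /= cy yl.
- by rewrite /= addr0 addrA lerD2r metric_triangle.
Qed.

Lemma length_split a c b : a <= c -> c <= b ->
  (curve_length gamma a b <= curve_length gamma a c + curve_length gamma c b)%E.
Proof.
move=> ac cb; apply: length_le => l abl.
have [l1 [l2 [p1 p2 h]]] := itv_partition_split ac cb abl.
apply: (@le_trans _ _ (plen a l1 + plen c l2)%:E); first by rewrite lee_fin.
by rewrite EFinD leeD// plen_le_length.
Qed.

Lemma lengthD a c b : a <= c -> c <= b ->
  curve_length gamma a b = (curve_length gamma a c + curve_length gamma c b)%E.
Proof.
move=> ac cb; apply/eqP; rewrite eq_le length_split//=.
have h l1 l2 : itv_partition a c l1 -> itv_partition c b l2 ->
    ((plen a l1)%:E + (plen c l2)%:E <= curve_length gamma a b)%E.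
  move=> p1 p2; have /plen_le_length := itv_partition_cat p1 p2.
  by rewrite plen_cat; case: p1 => _ /eqP ->; rewrite EFinD.
have := length_ge0 (le_trans ac cb).
case E : (curve_length gamma a b) => [r||] // _; last by rewrite leey.
(* Taking the supremum over partitions of [c, b] alone, with [l1] fixed, first shows that this
   length is finite; the subtraction needed for the supremum over [l1] is then legitimate. *)
have h1 l1 : itv_partition a c l1 ->
    (curve_length gamma c b <= r%:E - (plen a l1)%:E)%E.
  move=> p1; apply: length_le => l2 p2.
  by rewrite leeBrDl// -E h.
have cbf : curve_length gamma c b \is a fin_num.
  have [l1 p1] : exists l1, itv_partition a c l1.
    move: ac; rewrite le_eqVlt => /predU1P[<-|ac]; first by exists [::].
    by exists [:: c]; exact: itv_partition1.
  rewrite ge0_fin_numE ?length_ge0//.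
  by rewrite (le_lt_trans (h1 _ p1))// -EFinB ltry.
rewrite -leeBrDr//; apply: length_le => l1 /h1.
by rewrite -(fineK cbf) -!EFinB !lee_fin lerBrDl lerBrDr.
Qed.

Lemma le_length a b a' b' : a <= a' -> a' <= b' -> b' <= b ->
  (curve_length gamma a' b' <= curve_length gamma a b)%E.
Proof.
move=> aa ab bb; rewrite (@lengthD a a' b)// ?(le_trans ab)//.
rewrite (@lengthD a' b' b)//.
by apply: (le_trans (leeDl _ (length_ge0 bb))); rewrite leeDr// length_ge0.
Qed.

End CurveLength.

Section ArcLength.
Context {R : realType} {X : metricType R}.
Variables (gamma : R -> X) (a b : R).
Hypothesis rect : rectifiable_curve gamma a b.
Implicit Types (s t : R).

Let len t := fine (curve_length gamma a t).

Let ab : a <= b. Proof. by case: rect. Qed.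

Lemma curve_lengthE t : a <= t <= b -> curve_length gamma a t = (len t)%:E.
Proof.
move=> /andP[at_ tb]; rewrite fineK// ge0_fin_numE ?length_ge0//.
by case: rect => _ _; apply: le_lt_trans; rewrite le_length.
Qed.

Lemma curve_length_subE s t : a <= s -> s <= t -> t <= b ->
  curve_length gamma s t = (len t - len s)%:E.
Proof.
move=> as_ st tb; have := @lengthD _ _ gamma _ _ _ as_ st.
rewrite !curve_lengthE ?as_ ?(le_trans as_ st) ?(le_trans st)//.
have : curve_length gamma s t \is a fin_num.
  rewrite ge0_fin_numE ?length_ge0//.
  by case: rect => _ _; apply: le_lt_trans; rewrite le_length.
move=> /fineK <-; rewrite -EFinD => -[->]; congr _%:E; ring.
Qed.

Lemma arclen_a : len a = 0. Proof. by rewrite /len length_xx. Qed.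

Lemma arclen_dist s t : a <= s -> s <= t -> t <= b ->
  mdist (gamma s) (gamma t) <= len t - len s.
Proof.
move=> as_ st tb; have := @length_ge_dist _ _ gamma _ _ st.
by rewrite curve_length_subE.
Qed.

Lemma arclen_le s t : a <= s -> s <= t -> t <= b -> len s <= len t.
Proof.
move=> as_ st tb; rewrite -subr_ge0; apply: le_trans (arclen_dist as_ st tb).
exact: mdist_ge0.
Qed.

Lemma rect_continuous t e : a <= t <= b -> 0 < e ->
  exists2 d, 0 < d & forall t', a <= t' <= b -> `|t' - t| < d ->
    mdist (gamma t) (gamma t') < e.
Proof.
move=> tab e0; case: rect => _ /subspace_continuousP cont _.
have /cont /cvg_ballP /(_ e e0) : `[a, b]%classic t by rewrite /= in_itv.
rewrite near_withinE => /nbhs_ballP[d /= d0 h]; exists d => // t' t'ab t't.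
have tt' : ball t d t' by rewrite /ball /= distrC.
by have := h t' tt'; rewrite in_itv /= => /(_ t'ab); rewrite ballEmdist.
Qed.

(** In a partition of [a, t] the last point can be moved back to some t' < t; by continuity of the
    curve its polygonal length changes by less than [e]. With [arclen_right] this gives the
    continuity of arc length behind [arclen_surj]. *)
Lemma arclen_left t M : a < t -> t <= b ->
  (forall t', a <= t' -> t' < t -> len t' <= M) -> len t <= M.
Proof.
move=> at_ tb h; rewrite -lee_fin -curve_lengthE; last by rewrite ltW.
apply: length_le => l; case/lastP: l => [/itv_partition_nil/eqP|l y].
  by rewrite (lt_eqF at_).
rewrite /itv_partition rcons_path last_rcons => -[/andP[pl vy] /eqP yt].
subst y; set v := last a l in vy.
have av : a <= v by apply: (@itv_partition_le _ _ _ _ l); split.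
rewrite lee_fin; apply/ler_addgt0Pr => e e0.
have [|d d0 hd] := @rect_continuous t e _ e0; first by rewrite ltW.
pose t' := Num.max ((v + t) / 2) (t - d / 2).
have t't : t' < t by rewrite gt_max; apply/andP; split; lra.
have vt' : v < t' by rewrite lt_max; apply/orP; left; lra.
have at' : a <= t' by rewrite (le_trans av)// ltW.
have dt' : mdist (gamma t) (gamma t') < e.
  apply: hd; first by rewrite at' (le_trans _ tb)// ltW.
  rewrite ltr_distl; apply/andP; split; last by lra.
  by apply: (@lt_le_trans _ _ (t - d / 2)); [lra|rewrite le_max lexx orbT].
have := h _ at' t't; rewrite plen_rcons -/v.
have : (plen gamma a (rcons l t') <= len t').
  rewrite -lee_fin -curve_lengthE ?at' ?(le_trans (ltW t't))//.
  by apply: plen_le_length; rewrite /itv_partition rcons_path last_rcons pl.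
rewrite plen_rcons -/v => h1 h2.
have := metric_triangle (gamma v) (gamma t') (gamma t).
rewrite (metric_sym (gamma t') (gamma t)) => h3; lra.
Qed.

(** The mirror argument: the first point of a partition of [t, b] is moved forward. It bounds the
    remaining length [len b - len t], which says something about [len t] because the total length is
    finite. *)
Lemma arclen_right t M : a <= t -> t < b ->
  (forall t', t < t' -> t' <= b -> M <= len t') -> M <= len t.
Proof.
move=> at_ tb h.
suff : len b - len t <= len b - M by lra.
rewrite -lee_fin -curve_length_subE//; last exact: ltW.
apply: length_le => -[/itv_partition_nil/eqP|y l].
  by rewrite (lt_eqF tb).
move=> tyl; have := tyl; rewrite /itv_partition /= => -[/andP[ty yl] lb].
rewrite lee_fin; apply/ler_addgt0Pr => e e0.
have yb := itv_partition_le (itv_partition_cons tyl).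
have [|d d0 hd] := @rect_continuous t e _ e0; first by rewrite at_ ltW.
pose t' := Num.min ((y + t) / 2) (t + d / 2).
have t't : t < t' by rewrite lt_min; apply/andP; split; lra.
have vt' : t' < y by rewrite gt_min; apply/orP; left; lra.
have t'b : t' <= b by rewrite (le_trans _ yb)// ltW.
have at' : a <= t' by rewrite (le_trans at_)// ltW.
have dt' : mdist (gamma t) (gamma t') < e.
  apply: hd; first by rewrite at'.
  rewrite ltr_distl; apply/andP; split; first by lra.
  by apply: (@le_lt_trans _ _ (t + d / 2)); [rewrite ge_min lexx orbT|lra].
have := h _ t't t'b.
have : (plen gamma t' (y :: l) <= len b - len t').
  rewrite -lee_fin -curve_length_subE//.
  by apply: plen_le_length; rewrite /itv_partition /= vt' yl.
move=> /= h1 h2.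
have := metric_triangle (gamma t) (gamma t') (gamma y); lra.
Qed.

Lemma arclen_surj s : 0 <= s <= len b -> exists2 t, a <= t <= b & len t = s.
Proof.
move=> /andP[s0 sb].
pose A := [set t | a <= t <= b /\ len t <= s].
have Aa : A a by split; rewrite ?lexx ?ab// arclen_a.
have Ab : ubound A b by move=> t [/andP[]].
have hA : has_sup A by split; [exists a|exists b].
pose t := sup A.
have at_ : a <= t by apply: ub_le_sup => //; exists b.
have tb : t <= b by apply: ge_sup => //; exists a.
exists t; first by rewrite at_.
apply/eqP; rewrite eq_le; apply/andP; split.
  have [ta|ta] := eqVneq t a; first by rewrite ta arclen_a.
  have {}at_ : a < t by rewrite lt_neqAle eq_sym ta at_.
  apply: arclen_left => // t' at' t't.
  have [t2 [/andP[at2 t2b] h2] t't2] := sup_gt hA.1 t't.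
  by apply: le_trans h2; rewrite arclen_le// ltW.
have [tb'|tb'] := eqVneq t b; first by rewrite tb'.
have {}tb : t < b by rewrite lt_neqAle tb' tb.
apply: arclen_right => // t' tt' t'b; rewrite leNgt; apply/negP => h.
have : A t' by split; rewrite ?t'b ?andbT ?(le_trans at_) ?ltW.
by move=> /(ub_le_sup hA.2); rewrite leNgt tt'.
Qed.

Let sigma := arclength_param gamma a b.

Lemma arclength_param_len t : a <= t <= b -> sigma (len t) = gamma t.
Proof.
move=> tab; rewrite /sigma /arclength_param.
case: xgetP => [t' _ [t'ab]|/(_ t)]; last first.
  by move=> /not_andP[//|]; rewrite curve_lengthE.
rewrite curve_lengthE// => -[e].
move/andP: tab => [at_ tb]; move/andP: t'ab => [at' t'b].
apply: mdist_positivity; apply/eqP; rewrite eq_le mdist_ge0 andbT.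
have [tt'|t't] := leP t t'.
  by have := arclen_dist at_ tt' t'b; rewrite metric_sym e subrr.
by have := arclen_dist at' (ltW t't) tb; rewrite e subrr.
Qed.

Lemma arclength_param_lip s s' : 0 <= s <= len b -> 0 <= s' <= len b ->
  mdist (sigma s) (sigma s') <= `|s - s'|.
Proof.
move=> /arclen_surj[t tab <-] /arclen_surj[t' t'ab <-].
rewrite !arclength_param_len//.
move/andP: tab => [at_ tb]; move/andP: t'ab => [at' t'b].
have [tt'|t't] := leP t t'.
  rewrite distrC; apply: le_trans (ler_norm _); exact: arclen_dist.
by rewrite metric_sym; apply: le_trans (ler_norm _); apply: arclen_dist => //; exact: ltW.
Qed.

Lemma arclength_param0 : sigma 0 = gamma a.
Proof. by rewrite -arclen_a arclength_param_len// lexx. Qed.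

Lemma arclength_param_end : sigma (len b) = gamma b.
Proof. by rewrite arclength_param_len// lexx ab. Qed.

Lemma arclength_paramE s : 0 <= s <= len b ->
  exists2 t, a <= t <= b & sigma s = gamma t.
Proof.
by move=> /arclen_surj[t tab <-]; exists t; rewrite ?arclength_param_len.
Qed.

Lemma arclen_ge0 : 0 <= len b.
Proof. by rewrite -arclen_a; apply: arclen_le. Qed.

End ArcLength.

(** * Integrals along curves *)

Section Curves.
Context {R : realType} {X : pmetricType R}.

Lemma measurable_fun_within_comp (f : R -> X) (A : set R)
    (rho : g_sigma_algebraType (@open X) -> \bar R) :
  measurable A -> {within A, continuous f} ->
  measurable_fun setT rho -> measurable_fun A (rho \o f).
Proof.
move=> mA /continuousP cf mrho.
apply: (@measurable_comp _ _ _ _ _ _ setT) => //.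
apply: (@measurability _ _ _ (g_sigma_algebraType (@open X)) _ _ (@open X)) => //.
move=> _ [U oU <-]; have /open_subspaceP[V oV VA] := cf _ oU.
by rewrite setIC -VA; apply: measurableI => //; exact: open_measurable.
Qed.

Lemma lip_within_continuous (f : R -> X) (A : set R) (L : R) : 0 <= L ->
  (forall s t, A s -> A t -> mdist (f s) (f t) <= L * `|s - t|) ->
  {within A, continuous f}.
Proof.
move=> L0 lip; apply/subspace_continuousP => s As; apply/cvg_ballP => e e0.
rewrite near_withinE; apply/nbhs_ballP; exists (e / (L + 1)) => /=.
  by rewrite divr_gt0// ltr_wpDl.
move=> t st At; rewrite ballEmdist /=; have {}st : `|s - t| < e / (L + 1) := st.
apply: (le_lt_trans (lip _ _ As At)); move: st; rewrite ltr_pdivlMr; last by lra.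
have := normr_ge0 (s - t); nra.
Qed.

Lemma lip_curve_length (gamma : R -> X) a b (L : R) : 0 <= L -> a <= b ->
  (forall s t, a <= s <= b -> a <= t <= b ->
     mdist (gamma s) (gamma t) <= L * `|s - t|) ->
  (curve_length gamma a b <= (L * (b - a))%:E)%E.
Proof.
move=> L0 ab lip; apply: length_le => l abl; rewrite lee_fin.
have : a <= a by [].
elim: l {-2}a abl => [|y l ih] c cbl ac /=.
  by rewrite mulr_ge0// subr_ge0 (itv_partition_nil cbl).
have yb := itv_partition_le (itv_partition_cons cbl).
have cy : c < y by case: cbl => /= /andP[].
have ay : a <= y by rewrite (le_trans ac)// ltW.
have := ih y (itv_partition_cons cbl) ay.
have := lip c y; rewrite ac ay yb (le_trans (ltW cy) yb) => /(_ isT isT).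
by rewrite distrC gtr0_norm ?subr_gt0// => h1 h2; lra.
Qed.

Lemma lip_rectifiable (gamma : R -> X) a b (L : R) : 0 <= L -> a <= b ->
  (forall s t, a <= s <= b -> a <= t <= b ->
     mdist (gamma s) (gamma t) <= L * `|s - t|) ->
  rectifiable_curve gamma a b.
Proof.
move=> L0 ab lip; split => //.
  by apply: (@lip_within_continuous _ _ L) => // s t /=; rewrite !in_itv; exact: lip.
exact: le_lt_trans (lip_curve_length L0 ab lip) (ltry _).
Qed.

End Curves.

(** * Comparison of integrals over intervals *)

Section Integrals.
Context {R : realType}.
Notation leb := (@lebesgue_measure R).
Local Open Scope ereal_scope.

Lemma setU_itvcc (x y z : R) : (x <= y)%R -> (y <= z)%R ->
  `[x, z]%classic = `[x, y]%classic `|` `]y, z]%classic.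
Proof.
move=> xy yz; apply/seteqP; split => t /=; rewrite !in_itv /=.
  by move=> /andP[xt ->]; rewrite xt; case: leP; [left|right].
move=> [/andP[-> ty]|/andP[yt ->]]; first by rewrite (le_trans ty).
by rewrite (le_trans xy)// ltW.
Qed.

Lemma ge0_integral_itvcc (h : R -> \bar R) (x y z : R) : (x <= y)%R -> (y <= z)%R ->
  measurable_fun `[x, z] h -> (forall t : R, (x <= t <= z)%R -> 0 <= h t) ->
  \int[leb]_(t in `[x, z]) h t =
  \int[leb]_(t in `[x, y]) h t + \int[leb]_(t in `]y, z]) h t.
Proof.
move=> xy yz mh h0; rewrite (setU_itvcc xy yz) ge0_integral_setU//.
- by rewrite -setU_itvcc.
- by move=> t; rewrite -setU_itvcc//= in_itv; exact: h0.
- rewrite disj_set2E; apply/eqP/seteqP; split => // t [] /=; rewrite !in_itv /=.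
  by move=> /andP[_ ty] /andP[/lt_geF]; rewrite ty.
Qed.

Lemma lebesgue_itvoc (x y : R) : (x <= y)%R -> leb `]x, y]%classic = (y - x)%:E.
Proof.
rewrite lebesgue_measure_itv /= lte_fin le_eqVlt => /predU1P[->|->].
  by rewrite ltxx subrr.
by rewrite -EFinB.
Qed.

Lemma integral_itvoc_ge (h : R -> \bar R) (x y : R) (c : \bar R) : (x <= y)%R ->
  measurable_fun `]x, y] h -> 0 <= c ->
  (forall t : R, (x < t <= y)%R -> c <= h t) ->
  c * (y - x)%:E <= \int[leb]_(t in `]x, y]) h t.
Proof.
move=> xy mh c0 ch; rewrite -lebesgue_itvoc// -integral_cst//.
apply: ge0_le_integral => //.
Qed.

Lemma integral_itvoc_le (h : R -> \bar R) (x y : R) (c : \bar R) : (x <= y)%R ->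
  measurable_fun `]x, y] h -> (forall t : R, (x < t <= y)%R -> 0 <= h t) ->
  (forall t : R, (x < t <= y)%R -> h t <= c) ->
  \int[leb]_(t in `]x, y]) h t <= c * (y - x)%:E.
Proof.
move=> xy mh h0 ch; rewrite -lebesgue_itvoc// -integral_cst//.
apply: ge0_le_integral => //.
Qed.

(** A fundamental theorem of calculus without derivatives: short intervals are added up one by one.
    In the application [f] is plus or minus the chain cost along a curve, and [c] is the envelope at
    an endpoint of [s, t]. *)
Lemma increment_le_integral (f : R -> R) (h : R -> \bar R) (l e : R) :
  (0 <= l)%R -> (0 < e)%R ->
  measurable_fun `[0%R, l] h -> (forall t : R, (0 <= t <= l)%R -> 0 <= h t) ->
  (forall s t : R, (0 <= s)%R -> (s <= t)%R -> (t <= l)%R -> (t - s < e)%R ->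
    exists c : R, [/\ (0 <= c)%R, (f t - f s <= c * (t - s))%R &
      forall r : R, (s <= r <= t)%R -> c%:E <= h r]) ->
  (f l - f 0%R)%:E <= \int[leb]_(t in `[0%R, l]) h t.
Proof.
move=> l0 e0 mh h0 loc.
suff H : forall n (t : R), (0 <= t)%R -> (t <= l)%R -> (t <= n%:R * (e / 2))%R ->
    (f t - f 0%R)%:E <= \int[leb]_(t in `[0%R, t]) h t.
  have [n ln] : exists n, (l <= n%:R * (e / 2))%R.
    exists (Num.bound (l / (e / 2))); rewrite -ler_pdivrMr ?divr_gt0//.
    by rewrite ltW// archi_boundP// divr_ge0// ltW// divr_gt0.
  exact: H ln.
elim=> [|n ih] t t0 tl tn.
  have -> : t = 0%R by apply/eqP; rewrite eq_le t0 andbT; move: tn; rewrite mul0r.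
  rewrite subrr; apply: integral_ge0 => s /=; rewrite in_itv /= => /andP[s0 st].
  by apply: h0; rewrite s0 (le_trans st).
have [te|te] := leP t (e / 2)%R.
  have [|c [c0 fc ch]] := loc 0%R t (lexx _) t0 tl; first by lra.
  rewrite (@ge0_integral_itvcc _ _ 0%R)//; last 2 first.
  - by apply: measurable_funS mh => // s /=; rewrite !in_itv /= => /andP[-> /le_trans ->].
  - by move=> s /andP[s0 st]; apply: h0; rewrite s0 (le_trans st).
  apply: (@le_trans _ _ (c%:E * (t - 0)%:E)); first by rewrite lee_fin.
  rewrite -[leLHS]add0e; apply: leeD.
    apply: integral_ge0 => s /=; rewrite in_itv /= => /andP[s0 st].
    by apply: h0; rewrite s0 (le_trans st).
  apply: integral_itvoc_ge => //.
    apply: measurable_funS mh => // s /=; rewrite !in_itv /= => /andP[s0 st].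
    by rewrite ltW// (le_trans st).
  by move=> s /andP[s0 st]; apply: ch; rewrite ltW.
set s := (t - e / 2)%R.
have s0 : (0 <= s)%R by rewrite /s; lra.
have st : (s <= t)%R by rewrite /s; lra.
have sl : (s <= l)%R by rewrite (le_trans st).
have [|c [c0 fc ch]] := loc s t s0 st tl; first by rewrite /s; lra.
have /ih - /(_ s0 sl) IH : (s <= n%:R * (e / 2))%R.
  by move: tn; rewrite -natr1 mulrDl mul1r /s; lra.
rewrite (@ge0_integral_itvcc _ _ s)//; last 2 first.
- by apply: measurable_funS mh => // r /=; rewrite !in_itv /= => /andP[-> /le_trans ->].
- by move=> r /andP[r0 rt]; apply: h0; rewrite r0 (le_trans rt).
apply: (@le_trans _ _ ((f s - f 0)%:E + c%:E * (t - s)%:E)).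
  by rewrite -EFinM -EFinD lee_fin; lra.
apply: leeD => //; apply: integral_itvoc_ge => //.
  apply: measurable_funS mh => // r /=; rewrite !in_itv /= => /andP[r0 rt].
  by rewrite (le_trans _ (ltW r0))// (le_trans rt).
by move=> r /andP[r0 rt]; apply: ch; rewrite ltW.
Qed.

(** A change of variables without differentiating [len]. When t - s is at most [e / L], every value
    of [h1] on ]len s, len t] is at most every value of [h2] on ]s, t], so the supremum of the
    former separates the two integrands. The factor [L] is the ratio of the lengths of the two
    intervals. *)
Lemma integral_reparam_le (len : R -> R) (h1 h2 : R -> \bar R) (T L e : R) :
  (0 <= T)%R -> (0 < L)%R -> (0 < e)%R -> len 0%R = 0%R ->
  (forall s t : R, (0 <= s)%R -> (s <= t)%R -> (t <= T)%R ->
     (0 <= len t - len s <= L * (t - s))%R) ->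
  measurable_fun `[0%R, len T] h1 -> measurable_fun `[0%R, T] h2 ->
  (forall s : R, (0 <= s <= len T)%R -> 0 <= h1 s) ->
  (forall s : R, (0 <= s <= T)%R -> 0 <= h2 s) ->
  (forall s t : R, (0 <= s <= len T)%R -> (0 <= t <= T)%R -> (`|s - len t| <= e)%R ->
     h1 s <= h2 t) ->
  \int[leb]_(s in `[0%R, len T]) h1 s <= L%:E * \int[leb]_(t in `[0%R, T]) h2 t.
Proof.
move=> T0 L0 e0 len0 lip mh1 mh2 h10 h20 loc.
have lenle s t : (0 <= s)%R -> (s <= t)%R -> (t <= T)%R -> (len s <= len t)%R.
  by move=> s0 st tT; have /andP[] := lip s t s0 st tT; rewrite subr_ge0.
have len_ge0 t : (0 <= t)%R -> (t <= T)%R -> (0 <= len t)%R.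
  by move=> t0 tT; rewrite -len0 lenle.
pose d := (e / L)%R; have d0 : (0 < d)%R by rewrite divr_gt0.
have step s t : (0 <= s)%R -> (s <= t)%R -> (t <= T)%R -> (t - s <= d)%R ->
    \int[leb]_(r in `]len s, len t]) h1 r <= L%:E * \int[leb]_(r in `]s, t]) h2 r.
  move=> s0 st tT tsd.
  have lst := lenle s t s0 st tT.
  have ltT := lenle t T (le_trans s0 st) tT (lexx _).
  have ls0 := len_ge0 s s0 (le_trans st tT).
  have mh1' : measurable_fun `]len s, len t] h1.
    apply: measurable_funS mh1 => // r /=; rewrite !in_itv /= => /andP[r0 rt].
    by rewrite (le_trans ls0 (ltW r0))// (le_trans rt).
  have mh2' : measurable_fun `]s, t] h2.
    apply: measurable_funS mh2 => // r /=; rewrite !in_itv /= => /andP[r0 rt].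
    by rewrite (le_trans s0 (ltW r0))// (le_trans rt).
  have h20' r : (s < r <= t)%R -> 0 <= h2 r.
    by move=> /andP[sr rt]; apply: h20; rewrite (le_trans s0 (ltW sr)) (le_trans rt).
  have h10' r : (len s < r <= len t)%R -> 0 <= h1 r.
    by move=> /andP[sr rt]; apply: h10; rewrite (le_trans ls0 (ltW sr)) (le_trans rt).
  have i20 : 0 <= \int[leb]_(r in `]s, t]) h2 r.
    by apply: integral_ge0 => r /=; rewrite in_itv; exact: h20'.
  (* If [len s = len t], the supremum [M] below would be taken over the empty set and equal -oo. *)
  have [lst'|lst'] := eqVneq (len s) (len t).
    rewrite lst' set_itvoc0 integral_set0 mule_ge0//.
    by rewrite lee_fin ltW.
  have {}lst' : (len s < len t)%R by rewrite lt_neqAle lst'.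
  pose M := ereal_sup [set h1 r | r in `]len s, len t]%classic].
  have hM r : (len s < r <= len t)%R -> h1 r <= M.
    by move=> hr; apply: ereal_sup_ubound; exists r; rewrite //= in_itv.
  have M0 : 0 <= M.
    by apply: (le_trans (h10' (len t) _)); [rewrite lst' lexx|apply: hM; rewrite lst' lexx].
  have M2 r : (s < r <= t)%R -> M <= h2 r.
    move=> /andP[sr rt]; apply: ge_ereal_sup => _ [q /= + <-].
    rewrite in_itv /= => /andP[sq qt]; apply: loc.
    - by rewrite (le_trans ls0 (ltW sq)) (le_trans qt).
    - by rewrite (le_trans s0 (ltW sr)) (le_trans rt).
    have /andP[_ h] := lip s t s0 st tT.
    have := lenle s r s0 (ltW sr) (le_trans rt tT).
    have := lenle r t (le_trans s0 (ltW sr)) rt tT.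
    have : (L * (t - s) <= e)%R by move: tsd; rewrite /d ler_pdivlMr// mulrC.
    by rewrite ler_distl; lra.
  apply: (le_trans (integral_itvoc_le (ltW lst') mh1' h10' hM)).
  apply: (@le_trans _ _ (M * (L * (t - s))%:E)).
    by rewrite lee_pmul// lee_fin ?subr_ge0 ?(ltW lst')//; have /andP[] := lip s t s0 st tT.
  rewrite EFinM muleCA lee_pmul2l ?lte_fin//.
  exact: integral_itvoc_ge.
suff H : forall n (t : R), (0 <= t)%R -> (t <= T)%R -> (t <= n%:R * d)%R ->
    \int[leb]_(s in `[0%R, len t]) h1 s <= L%:E * \int[leb]_(r in `[0%R, t]) h2 r.
  have [n ln] : exists n, (T <= n%:R * d)%R.
    exists (Num.bound (T / d)); rewrite -ler_pdivrMr//.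
    by rewrite ltW// archi_boundP// divr_ge0// ltW.
  exact: H ln.
elim=> [|n ih] t t0 tT tn.
  have -> : t = 0%R by apply/eqP; rewrite eq_le t0 andbT; move: tn; rewrite mul0r.
  rewrite len0 set_itv1 integral_set1 mule_ge0//; first by rewrite lee_fin ltW.
  by apply: integral_ge0 => s /= ->; apply: h20; rewrite lexx.
pose s := Num.max 0%R (t - d)%R.
have s0 : (0 <= s)%R by rewrite le_max lexx.
have st : (s <= t)%R by rewrite ge_max t0 /=; lra.
have sT := le_trans st tT.
have tsd : (t - s <= d)%R.
  have : (t - d <= s)%R by rewrite le_max lexx orbT.
  by lra.
have sn : (s <= n%:R * d)%R.
  have nd0 : (0 <= n%:R * d)%R by rewrite mulr_ge0// ltW.
  rewrite ge_max nd0 /=.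
  by move: tn; rewrite -natr1 mulrDl mul1r; lra.
have ls0 := len_ge0 s s0 sT.
have lst := lenle s t s0 st tT.
have ltT := lenle t T t0 tT (lexx _).
rewrite (@ge0_integral_itvcc h1 _ (len s))//; last 2 first.
- by apply: measurable_funS mh1 => // r /=; rewrite !in_itv /= => /andP[-> /le_trans ->].
- by move=> r /andP[r0 rt]; apply: h10; rewrite r0 (le_trans rt).
rewrite (@ge0_integral_itvcc h2 _ s)//; last 2 first.
- by apply: measurable_funS mh2 => // r /=; rewrite !in_itv /= => /andP[-> /le_trans ->].
- by move=> r /andP[r0 rt]; apply: h20; rewrite r0 (le_trans rt).
rewrite ge0_muleDr; last 2 first.
- apply: integral_ge0 => r /=; rewrite in_itv /= => /andP[r0 rt].
  by apply: h20; rewrite r0 (le_trans rt).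
- apply: integral_ge0 => r /=; rewrite in_itv /= => /andP[r0 rt].
  by apply: h20; rewrite (le_trans s0 (ltW r0)) (le_trans rt).
by apply: leeD; [exact: ih|exact: step].
Qed.

End Integrals.

(** * Outer regularity and lower semicontinuous majorants *)

Lemma metric_ball_open {R : realType} {X : metricType R} (x : X) (r : R) :
  open (ball x r).
Proof.
rewrite openE => y; rewrite ballEmdist /= => xy.
apply/nbhs_ballP; exists (r - mdist x y) => /=; first by rewrite subr_gt0.
move=> z; rewrite !ballEmdist /= => yz.
by rewrite (le_lt_trans (metric_triangle x y z))// -ltrBrDl.
Qed.

Section OuterRegularity.
Context {R : realType} {X : pmetricType R}.
Variable mu : {outer_measure set X -> \bar R}.
Hypothesis borel_cara : <<s @open X >> `<=` mu.-caratheodory.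

Lemma borel_measurable (A : set X) : <<s @open X >> A ->
  measurable (A : set (caratheodory_type mu)).
Proof. exact: borel_cara. Qed.

Lemma open_cara (A : set X) : open A -> measurable (A : set (caratheodory_type mu)).
Proof. by move=> oA; apply: borel_measurable; exact: sub_gen_smallest. Qed.

Lemma borel_measurable_fun d (Y : measurableType d) (f : X -> Y) :
  measurable_fun setT (f : g_sigma_algebraType (@open X) -> Y) ->
  measurable_fun setT (f : caratheodory_type mu -> Y).
Proof. by move=> mf mT B mB; apply: borel_measurable; exact: mf. Qed.

(** Approximation from both sides is symmetric under complements, so the squeezed sets form a
    sigma-algebra, whereas outer approximation alone would not visibly pass to complements.
    Measuring inside [B], of finite measure, allows continuity from above. *)
Let squeezed (B A : set X) := forall e : R, 0 < e -> exists F U : set X,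
  [/\ closed F, open U, F `<=` A, A `<=` U &
      (mu ((U `\` F) `&` B) <= e%:E)%E].

Let squeezedC B A : squeezed B A -> squeezed B (~` A).
Proof.
move=> h e /h[F [U [cF oU FA AU le]]]; exists (~` U), (~` F); split.
- exact: open_closedC.
- exact: closed_openC.
- exact: subsetC.
- exact: subsetC.
- have -> : ~` F `\` ~` U = U `\` F by rewrite !setDE setCK setIC.
by [].
Qed.

Let decreasing_small (D : (set X)^nat) (e : \bar R) :
  (forall n, measurable (D n : set (caratheodory_type mu))) ->
  nonincreasing_seq D -> (mu (D 0%N) < +oo)%E ->
  (mu (\bigcap_n D n) < e)%E -> exists n, (mu (D n) < e)%E.
Proof.
move=> mD dD D0 lte; apply: contrapT => h.
have := @nonincreasing_cvg_mu _ (caratheodory_type mu) R (cara mu) D D0 mD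
  (bigcap_measurable _ (fun k _ => mD k)) dD.
move=> /(_ (ex_intro _ 0%N I)) c.
move: lte; apply/negP; rewrite -leNgt -(cvg_lim (@ereal_hausdorff R) c).
apply: lime_ge; first by apply/cvg_ex; exists (mu (\bigcap_n D n)).
by apply: nearW => n; rewrite leNgt; apply/negP => hn; apply: h; exists n.
Qed.

Variable B : set X.
Hypotheses (oB : open B) (muB : (mu B < +oo)%E).

Let squeezed_bigcup (A : (set X)^nat) : (forall n, squeezed B (A n)) ->
  squeezed B (\bigcup_n A n).
Proof.
move=> h e e0.
have e2 n : 0 < e / 2 / (2 ^ n.+1)%:R by rewrite !divr_gt0.
have /choice[F] : forall n, exists F : set X, exists U : set X,
    [/\ closed F, open U, F `<=` A n, A n `<=` U &
      (mu ((U `\` F) `&` B) <= (e / 2 / (2 ^ n.+1)%:R)%:E)%E].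
  by move=> n; exact: h.
move=> /choice[U FU].
(* An infinite union of closed sets need not be closed, so only the first [N] of them are kept. The
   sets [D N] decrease to a set of measure at most [e / 2]. *)
pose D N := ((\bigcup_n U n) `\` (\bigcup_(n in [set k | (k < N)%N]) F n)) `&` B.
have cF N : closed (\bigcup_(n in [set k | (k < N)%N]) F n).
  by apply: closed_bigcup => [|i _]; [exact: finite_II|case: (FU i)].
have oU : open (\bigcup_n U n) by apply: bigcup_open => i _; case: (FU i).
have mD N : measurable (D N : set (caratheodory_type mu)).
  apply: open_cara; rewrite /D setDE; apply: openI => //.
  by apply: openI => //; exact: closed_openC.
have DB N : D N `<=` B by move=> x [].
have [|||N ltN] := @decreasing_small D e%:E mD.
- apply/nonincreasing_seqP => N; apply/subsetPset => x [[xU xF] xB]; split => //.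
  by split => // -[n /= nN Fx]; apply: xF; exists n => //=; exact: ltnW.
- by apply: le_lt_trans muB; apply: le_outer_measure; exact: DB.
- apply: (@le_lt_trans _ _ (e / 2)%:E); last by rewrite lte_fin; lra.
  apply: (@le_trans _ _ (mu (\bigcup_n ((U n `\` F n) `&` B)))).
    apply: le_outer_measure => x Dx; have [[[n _ Ux] _] xB] := Dx 0%N I.
    exists n => //; split => //; split => // Fx.
    by have [[_ +] _] := Dx n.+1 I; apply; exists n => //=.
  apply: (le_trans (outer_measure_sigma_subadditive mu _)).
  apply: (@le_trans _ _ (\sum_(i <oo) (e / 2 / (2 ^ i.+1)%:R)%:E)%E).
    apply: lee_nneseries => n _; first by move=> _; exact: outer_measure_ge0.
    by case: (FU n).
  by apply: (@epsilon_trick0 R (e / 2) xpredT); rewrite divr_ge0// ltW.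
exists (\bigcup_(n in [set k | (k < N)%N]) F n), (\bigcup_n U n); split => //.
- by move=> x [n _ Fx]; exists n => //; case: (FU n) => _ _ + _ _; exact.
- by move=> x [n _ Ax]; exists n => //; case: (FU n) => _ _ _ + _; exact.
- exact: ltW.
Qed.

Let squeezed_open (A : set X) : open A -> squeezed B A.
Proof.
move=> oA e e0.
(* These closed sets of points deep inside [A] increase to [A], because [A] is open. *)
pose F N := [set x : X | ball x N.+1%:R^-1 `<=` A].
have cF N : closed (F N).
  rewrite -[F N]setCK; apply: open_closedC; rewrite openE => x /= xA.
  have [y [xy Ay]] : exists y, ball x N.+1%:R^-1 y /\ ~ A y.
    by apply: contrapT => h; apply: xA => y xy; apply: contrapT => Ay; apply: h; exists y.
  apply/nbhs_ballP; exists (N.+1%:R^-1 - mdist x y) => /=.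
    by rewrite subr_gt0; move: xy; rewrite ballEmdist.
  move=> z; rewrite ballEmdist /= => xz zA; apply: Ay; apply: zA.
  rewrite ballEmdist /=; apply: (le_lt_trans (metric_triangle _ x _)).
  by rewrite (metric_sym z x) -ltrBrDr.
pose D N := (A `\` F N) `&` B.
have mD N : measurable (D N : set (caratheodory_type mu)).
  apply: open_cara; rewrite /D setDE; apply: openI => //.
  by apply: openI => //; exact: closed_openC.
have [|||N ltN] := @decreasing_small D e%:E mD.
- apply/nonincreasing_seqP => N; apply/subsetPset => x [[xU xF] xB]; split => //.
  split => // xFN; apply: xF; apply: subset_trans xFN; apply: le_ball.
  by rewrite lef_pV2 ?posrE// ler_nat.
- by apply: le_lt_trans muB; apply: le_outer_measure => x [].
- rewrite (_ : \bigcap_n D n = set0) ?outer_measure0 ?lte_fin//.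
  apply/seteqP; split => // x Dx.
  have [[Ax _] _] := Dx 0%N I.
  have /nbhs_ballP[d /= d0 hd] : nbhs x A by exact: open_nbhs_nbhs.
  have [[_ h] _] := Dx (Num.bound d^-1) I; apply: h.
  apply: subset_trans hd; apply: le_ball; rewrite invf_ple ?posrE//.
  rewrite ltW// (@lt_le_trans _ _ (Num.bound d^-1)%:R) ?ler_nat//.
  by rewrite archi_boundP// invr_ge0 ltW.
exists (F N), A; split => //; last exact: ltW.
by move=> x; apply; exact: ballxx.
Qed.

Lemma borel_outer_regular (E : set X) (e : R) : <<s @open X >> E -> E `<=` B -> 0 < e ->
  exists U : set X, [/\ open U, E `<=` U, U `<=` B & (mu U <= mu E + e%:E)%E].
Proof.
move=> bE EB e0.
have : squeezed B E.
  suff : <<s @open X >> `<=` squeezed B by apply.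
  apply: smallest_sub => //; split => //.
  - by apply: squeezed_open; exact: open0.
  - by move=> A hA; rewrite setTD; exact: squeezedC.
move=> /(_ e e0)[F [U [cF oU FE EU le]]].
exists (U `&` B); split.
- exact: openI.
- by move=> x Ex; split; [exact: EU|exact: EB].
- by move=> x [].
apply: (@le_trans _ _ (mu (E `|` ((U `\` F) `&` B)))).
  apply: le_outer_measure => x [Ux Bx].
  by have [Ex|Ex] := pselect (E x); [left|right; split => //; split => // /FE].
by apply: (le_trans (outer_measureU2 mu _ _)); rewrite leeD2l.
Qed.

End OuterRegularity.

Section LscMajorant.
Context {R : realType} {X : pmetricType R}.
Variable mu : {outer_measure set X -> \bar R}.
Hypothesis borel_cara : <<s @open X >> `<=` mu.-caratheodory.
Local Open Scope ereal_scope.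

(** Layer [k = 0] is present for every [v >= 0]. Hence the sum of the layers overshoots [v], by at
    most [theta]; the same layer later keeps the majorant above [theta] on [B]. *)
Let layer (theta : R) (k : nat) (v : \bar R) : \bar R :=
  if (k%:R * theta)%:E <= v then theta%:E else 0.

Let layer_ge0 theta k v : (0 < theta)%R -> 0 <= layer theta k v.
Proof. by move=> t0; rewrite /layer; case: ifP => // _; rewrite lee_fin ltW. Qed.

Let layer_sum_le theta v n : (0 < theta)%R -> 0 <= v ->
  \sum_(0 <= k < n) layer theta k v <= v + theta%:E.
Proof.
move=> t0 v0.
suff : \sum_(0 <= k < n) layer theta k v <= (n%:R * theta)%:E /\
       \sum_(0 <= k < n) layer theta k v <= v + theta%:E by case.
elim: n => [|n [ih1 ih2]].
  by rewrite big_geq// mul0r; split => //; rewrite adde_ge0// lee_fin ltW.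
rewrite big_nat_recr//= -natr1 mulrDl mul1r EFinD /layer.
case: ifPn => h.
  split; first by rewrite leeD2r.
  by rewrite leeD2r// (le_trans ih1).
by rewrite adde0; split => //; rewrite (le_trans ih1)// leeDl// lee_fin ltW.
Qed.

Let layer_sum_full theta v n : (0 < theta)%R -> (n%:R * theta)%:E <= v ->
  (n.+1%:R * theta)%:E <= \sum_(k <oo) layer theta k v.
Proof.
move=> t0 nv; apply: (@le_trans _ _ (\sum_(0 <= k < n.+1) layer theta k v)); last first.
  by apply: nneseries_lim_ge => *; exact: layer_ge0.
rewrite big_nat_cond (eq_bigr (fun=> theta%:E)); last first.
  move=> k /andP[/andP[_ kn] _]; rewrite /layer ifT// (le_trans _ nv)// lee_fin.
  by rewrite ler_pM2r// ler_nat.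
by rewrite -big_nat_cond sumEFin sumr_const_nat subn0 mulr_natl.
Qed.

Let layer_sum_ge theta v : (0 < theta)%R -> 0 <= v ->
  v <= \sum_(k <oo) layer theta k v.
Proof.
move=> t0; case: v => [v||] // v0.
  have vt0 : (0 <= v / theta)%R by rewrite divr_ge0// ltW.
  have /andP[h1 h2] := truncn_itv vt0.
  apply: (@le_trans _ _ ((Num.truncn (v / theta)).+1%:R * theta)%:E).
    by rewrite lee_fin -ler_pdivrMr// ltW.
  by apply: layer_sum_full => //; rewrite lee_fin -ler_pdivlMr.
rewrite leye_eq; apply/eqP/eqyP => A A0.
have [n An] : exists n, (A <= n%:R * theta)%R.
  exists (Num.bound (A / theta)); rewrite -ler_pdivrMr//.
  by rewrite ltW// archi_boundP// divr_ge0// ltW.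
apply: (@le_trans _ _ (n.+1%:R * theta)%:E); last by apply: layer_sum_full; rewrite // leey.
by rewrite lee_fin (le_trans An)// ler_pM2r// ler_nat.
Qed.

(* Vitali-Caratheodory: the layer-cake sum of [f], with each superlevel set
   replaced by a slightly larger open set. *)
Lemma lsc_majorant (B : set X) (f : X -> \bar R) (theta : R) :
  open B -> 0 < mu B -> mu B < +oo -> (0 < theta)%R ->
  measurable_fun setT (f : g_sigma_algebraType (@open X) -> \bar R) ->
  (forall x, 0 <= f x) ->
  exists h : X -> \bar R, [/\ forall x, 0 <= h x,
    forall a, open [set x | a < h x],
    forall x, B x -> f x <= h x,
    forall x, B x -> theta%:E <= h x &
    \int[cara mu]_x h x <= \int[cara mu]_(x in B) f x + (2 * theta)%:E * mu B].
Proof.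
move=> oB mB0 mBoo t0 mf f0.
set m := fine (mu B).
have mE : mu B = m%:E by rewrite fineK// ge0_fin_numE// ltW.
have m0 : (0 < m)%R by rewrite -lte_fin -mE.
pose E k := B `&` [set x | (k%:R * theta)%:E <= f x].
have bE k : <<s @open X >> (E k).
  have -> : E k = B `&` (setT `&` f @^-1` [set y | (k%:R * theta)%:E <= y]).
    by rewrite setTI.
  apply: (@measurableI _ (g_sigma_algebraType (@open X))).
    exact: sub_gen_smallest.
  apply: mf => //.
  have -> : [set y | (k%:R * theta)%:E <= y] = `[(k%:R * theta)%:E, +oo]%classic.
    by apply/seteqP; split => y /=; rewrite in_itv /= ?leey ?andbT.
  exact: emeasurable_itv.
have EB k : E k `<=` B by move=> x [].
(* Weighted by [theta], these errors sum to [theta * m]. The other [theta * m] in the bound is the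
   overshoot of the layer-cake sum of [f]. *)
have e0 k : (0 < m / (2 ^ k.+1)%:R)%R by rewrite divr_gt0.
have /choice[U UE] k := borel_outer_regular borel_cara oB mBoo (bE k) (@EB k) (e0 k).
have oU k : open (U k) by case: (UE k).
have mU k := open_cara borel_cara (oU k).
have mE' k := borel_measurable borel_cara (bE k).
have mB := open_cara borel_cara oB.
pose s (V : set X) (x : X) : \bar R := (theta * \1_V x)%:E.
have s0 V x : 0 <= s V x by rewrite lee_fin mulr_ge0// ltW.
have ms (V : set X) (D : set (caratheodory_type mu)) :
    measurable (V : set (caratheodory_type mu)) ->
    measurable_fun D (s V : caratheodory_type mu -> \bar R).
  move=> mV; apply/measurable_EFinP; apply: measurable_funM => //.
have ints (V : set X) (D : set (caratheodory_type mu)) :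
    measurable (V : set (caratheodory_type mu)) ->
    measurable D ->
    \int[cara mu]_(x in D) s V x = theta%:E * mu (V `&` D).
  move=> mV mD; under eq_integral do rewrite /s EFinM.
  rewrite ge0_integralZl_EFin//; last 2 first.
  - by apply/measurable_EFinP.
  - exact: ltW.
  by rewrite integral_indic.
exists (fun x => \sum_(k <oo) s (U k) x); split.
- by move=> x; apply: nneseries_ge0 => *.
- move=> a; rewrite openE => x /= ax.
  have [n an] : exists n, a < \sum_(0 <= k < n) s (U k) x.
    apply: contrapT => h; move: ax; apply/negP; rewrite -leNgt.
    apply: lime_le; first by apply: is_cvg_nneseries => *.
    by apply: nearW => n; rewrite leNgt; apply/negP => hn; apply: h; exists n.
  suff : \forall y \near x, \sum_(0 <= k < n) s (U k) x <= \sum_(0 <= k < n) s (U k) y.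
    apply: filterS => y le; apply: (lt_le_trans an); apply: (le_trans le).
    exact: nneseries_lim_ge.
  elim: n {an} => [|n ih]; first by apply: nearW => y; rewrite !big_geq.
  have : \forall y \near x, s (U n) x <= s (U n) y.
    have [Ux|Ux] := pselect (U n x); last first.
      by apply: nearW => y; rewrite /s indicE memNset//= mulr0; exact: s0.
    have := open_nbhs_nbhs (conj (oU n) Ux); apply: filterS => y Uy.
    by rewrite /s !indicE !mem_set.
  by move: ih; apply: filterS2 => y le1 le2; rewrite !big_nat_recr//= leeD.
- move=> x Bx; apply: (le_trans (layer_sum_ge t0 (f0 x))).
  apply: lee_nneseries => k _; first by move=> _; exact: layer_ge0.
  rewrite /layer; case: ifPn => // h; rewrite /s indicE mem_set ?mulr1//.
  by case: (UE k) => _ + _ _; apply.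
- move=> x Bx; apply: (@le_trans _ _ (\sum_(0 <= k < 1) s (U k) x)); last first.
    exact: nneseries_lim_ge.
  rewrite big_nat1 /s indicE mem_set ?mulr1//.
  by case: (UE 0%N) => _ + _ _; apply; split => //=; rewrite mul0r.
rewrite integral_nneseries//; last by move=> k; exact: ms.
apply: (@le_trans _ _ (\sum_(k <oo) (theta%:E * mu (E k) +
    (theta * m / (2 ^ k.+1)%:R)%:E))).
  apply: lee_nneseries => k _; first by move=> _; exact: integral_ge0.
  rewrite ints// setIT -mulrA EFinM -ge0_muleDr//; last by rewrite lee_fin ltW.
  by rewrite lee_pmul2l ?lte_fin//; case: (UE k).
apply: (le_trans (epsilon_trick _ _ _)).
- by move=> k; rewrite mule_ge0// lee_fin ltW.
- by rewrite mulr_ge0// ltW.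
rewrite mulr_natl mulr2n EFinD ge0_muleDl ?lee_fin ?(ltW t0)//.
rewrite addeA mE -EFinM leeD2r//.
apply: (@le_trans _ _ (\int[cara mu]_(x in B) (\sum_(k <oo) s (E k) x))).
  rewrite integral_nneseries//; last by move=> k; exact: ms.
  by apply: lee_nneseries => k _; [move=> _; rewrite mule_ge0// lee_fin ltW|
     rewrite ints// setIidl].
have mfB : measurable_fun (B : set (caratheodory_type mu)) (f : caratheodory_type mu -> \bar R).
  by apply: measurable_funTS; exact: borel_measurable_fun.
rewrite EFinM -mE -(integral_cst (cara mu) mB) -ge0_integralD//; last first.
  by move=> x _; rewrite lee_fin ltW.
apply: ge0_le_integral => //.
- by move=> x _; apply: nneseries_ge0 => *.
- by apply: ge0_emeasurable_sum => k *; [exact: s0|exact: ms].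
- by apply: emeasurable_funD.
move=> x Bx; apply: lime_le; first by apply: is_cvg_nneseries => *.
apply: nearW => n; apply: (le_trans _ (layer_sum_le n t0 (f0 x))).
apply: lee_sum => k _; rewrite /s /layer indicE; case: ifPn => h.
  by rewrite lee_fin ler_piMr ?(ltW t0)//; case: (_ \in _).
by rewrite memNset ?mulr0// => -[_ /=]; apply/negP.
Qed.

End LscMajorant.

(** * Compactness of balls and limits of almost Lipschitz maps *)

Section Compactness.
Context {R : realType} {X : completePMetricType R}.
Variables (Q : R) (mu : {outer_measure set X -> \bar R}).
Hypothesis borel_cara : <<s @open X >> `<=` mu.-caratheodory.
Hypothesis ahlfors : ahlfors_regular Q mu.

(** Volume comparison: the balls of radius [e] about the points are disjoint, have measure at least
    [c], and lie in [ball x (r + e)]. *)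
Lemma separated_size_bound (x : X) (r e : R) : 0 < r -> 0 < e -> exists n : nat,
  forall s : seq X, pairwise (fun z y => 2 * e <= mdist z y) s ->
    (forall z, z \in s -> ball x r z) -> (size s <= n)%N.
Proof.
move=> r0 e0; have [C C1 hC] := ahlfors.
have C0 : 0 < C by exact: lt_le_trans C1.
pose c := e `^ Q / C; have c0 : 0 < c by rewrite divr_gt0// powR_gt0.
pose V := C * (r + e) `^ Q.
have V0 : 0 < V by rewrite mulr_gt0// powR_gt0// addr_gt0.
exists (Num.truncn (V / c)) => s sep sb.
pose U (l : seq X) := [set y | exists2 z, z \in l & ball z e y].
have H l : pairwise (fun z y => 2 * e <= mdist z y) l ->
    measurable (U l : set (caratheodory_type mu)) /\
    (((size l)%:R * c)%:E <= mu (U l))%E.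
  elim: l => [_|z l ih].
    rewrite (_ : U [::] = set0); last by apply/seteqP; split => // y [].
    by rewrite mul0r; split; [exact: measurable0|rewrite outer_measure_ge0].
  rewrite pairwise_cons => /andP[zl /ih [mUl le]].
  have -> : U (z :: l) = ball z e `|` U l.
    apply/seteqP; split => y.
      by move=> [w]; rewrite inE => /predU1P[->|wl] hw; [left|right; exists w].
    by move=> [h|[w wl hw]]; [exists z; rewrite ?mem_head|exists w; rewrite // inE wl orbT].
  have mz : measurable (ball z e : set (caratheodory_type mu)).
    exact: (open_cara borel_cara (metric_ball_open _ _)).
  split; first exact: measurableU.
  have -> : mu (ball z e `|` U l) = (mu (ball z e) + mu (U l))%E.
    apply: (measureU (cara mu) mz mUl).
    apply/seteqP; split => // y [zy [w wl wy]].
    move/allP : zl => /(_ _ wl); apply/negP; rewrite -ltNge.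
    move: zy wy; rewrite !ballEmdist /= => zy wy.
    by rewrite (le_lt_trans (metric_triangle z y w))// (metric_sym y w); lra.
  rewrite /= -natr1 mulrDl mul1r addrC EFinD; apply: leeD => //.
  by have /andP[] := hC z e e0.
have [_ le] := H s sep.
rewrite truncn_ge_nat; last by rewrite divr_ge0 // ltW.
rewrite ler_pdivlMr// -lee_fin.
apply: (le_trans le); have /andP[_] := hC x (r + e) (addr_gt0 r0 e0).
apply: le_trans; apply: le_outer_measure => y [z /sb].
by rewrite !ballEmdist /= => xz zy; rewrite (le_lt_trans (metric_triangle x z y))// ltrD.
Qed.

Lemma ball_finite_cover (x : X) (r e : R) : 0 < r -> 0 < e ->
  exists s : seq X, forall y, ball x r y -> exists2 z, z \in s & ball z e y.
Proof.
move=> r0 e0; have e2 : 0 < e / 2 by rewrite divr_gt0.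
have [n hn] := separated_size_bound x r0 e2.
apply: contrapT => h.
have {}h (s : seq X) : exists y, ball x r y /\ forall z, z \in s -> e <= mdist z y.
  apply: contrapT => h'; apply: h; exists s => y xy; apply: contrapT => ys.
  apply: h'; exists y; split => // z zs; rewrite leNgt; apply/negP => zy.
  by apply: ys; exists z => //; rewrite ballEmdist.
suff [s [ss sep sb]] : exists s : seq X, [/\ size s = n.+1,
    pairwise (fun z y => 2 * (e / 2) <= mdist z y) s & forall z, z \in s -> ball x r z].
  by have := hn s sep sb; rewrite ss ltnn.
elim: (n.+1) => [|k [s [ss sep sb]]]; first by exists [::].
have [y [xy ys]] := h s; exists (y :: s); split.
- by rewrite /= ss.
- rewrite pairwise_cons sep andbT; apply/allP => z /ys.
  by rewrite metric_sym mulrC divfK.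
- by move=> z; rewrite inE => /predU1P[->|/sb].
Qed.

Lemma closed_ball_compact (x : X) (r : R) : compact [set y | mdist x y <= r].
Proof.
rewrite compact_ultra => F UF FA.
have cF : cauchy F.
  apply: cauchy_exP => e e0.
  (* The radius is positive and exceeds [r] whatever the sign of [r], so the open ball covered
     contains the closed one. *)
  have [s hs] := @ball_finite_cover x (`|r| + 1) e (ltr_wpDl (normr_ge0 _) ltr01) e0.
  apply: contrapT => h.
  have FC z : F (~` ball z e).
    by case: (in_ultra_setVsetC (ball z e) UF) => // Fz; exfalso; apply: h; exists z.
  have : F [set y | forall z, z \in s -> ~ ball z e y].
    elim: s {hs} => [|z s ih]; first by apply: filterS FA => y _ z.
    apply: filterS2 ih (FC z) => y ys zy w.
    by rewrite inE => /predU1P[->|]; [exact: zy|exact: ys].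
  move=> /(filterI FA) /filter_ex[y [/= xy ys]].
  have [|z zs zy] := hs y; last exact: (ys z).
  by rewrite ballEmdist /= (le_lt_trans xy)// (le_lt_trans (ler_norm r))// ltrDl.
have Fp : F --> lim F by exact: (cauchy_cvg F cF).
set p := lim F in Fp.
exists p; split => //=; rewrite leNgt; apply/negP => rp.
have e0 : 0 < mdist x p - r by rewrite subr_gt0.
have /(filterI FA) /filter_ex[y [/= xy]] : F (ball p (mdist x p - r)).
  by apply: Fp; exact: nbhsx_ballx.
rewrite ballEmdist /= => py.
have := metric_triangle x y p; rewrite (metric_sym y p); lra.
Qed.

End Compactness.

Section LimitCurve.
Context {R : realType} {X : metricType R}.

(** Arzela-Ascoli for maps that may jump, with jumps tending to 0. The limit along an ultrafilter on
    the indices is taken at all times simultaneously and replaces a diagonal subsequence; a finite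
    grid then gives uniform closeness along some arbitrarily large indices. *)
Lemma asymptotically_lip_limit (K : set X) (f : nat -> R -> X) (L : R) (e : nat -> R) :
  compact K -> (forall n t, K (f n t)) -> 0 <= L -> (forall n, 0 <= e n) ->
  (forall eta, 0 < eta -> \forall n \near \oo, e n < eta) ->
  (forall n s t, 0 <= s <= 1 -> 0 <= t <= 1 ->
     mdist (f n s) (f n t) <= L * `|s - t| + e n) ->
  exists2 gamma : R -> X,
    (forall s t, 0 <= s <= 1 -> 0 <= t <= 1 ->
       mdist (gamma s) (gamma t) <= L * `|s - t|) &
    forall eta (m : nat), 0 < eta -> exists2 n, (m <= n)%N &
      forall t, 0 <= t <= 1 -> mdist (f n t) (gamma t) < eta.
Proof.
move=> cK Kf L0 e0 elim lip.
have [U [UU ooU]] := ultraFilterLemma (@eventually_filter).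
have /choice[gamma hg] : forall t, exists y, forall eta, 0 < eta ->
    U [set n | mdist (f n t) y < eta].
  move=> t; have UK : U [set n | K (f n t)] by apply: filterS filterT => n _; exact: Kf.
  have [y [_ yc]] := cK (f^~ t @ U) _ UK.
  exists y => eta eta0; pose A := [set n | mdist (f n t) y < eta].
  case: (in_ultra_setVsetC A UU) => // UA; exfalso.
  have [|z [/= hz]] := yc [set z | ~ mdist z y < eta] (ball y eta) _ (nbhsx_ballx y _ eta0).
    exact: UA.
  by rewrite ballEmdist /= metric_sym.
have UI A B : U A -> U B -> U (A `&` B) by exact: filterI.
have Uex P : U P -> exists n, P n by exact: filter_ex.
have small (eta : R) m : 0 < eta -> U [set n | (m <= n)%N /\ e n < eta].
  move=> eta0; apply: ooU; apply: filterI; first by exists m.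
  exact: elim.
have glip s t : 0 <= s <= 1 -> 0 <= t <= 1 ->
    mdist (gamma s) (gamma t) <= L * `|s - t|.
  move=> hs ht; apply/ler_addgt0Pr => eta eta0.
  have eta3 : 0 < eta / 3 by rewrite divr_gt0.
  have := UI _ _ (small _ 0%N eta3) (UI _ _ (hg s _ eta3) (hg t _ eta3)).
  move=> /Uex[n [[/= _ en] [/= ns nt]]].
  have := metric_triangle (gamma s) (f n s) (gamma t).
  have := metric_triangle (f n s) (f n t) (gamma t).
  rewrite (metric_sym (gamma s) (f n s)); have := lip n s t hs ht; lra.
exists gamma => // eta m eta0.
have eta4 : 0 < eta / 4 by rewrite divr_gt0.
(* Mesh [1 / k]. Going from [f n t] to [gamma t] through a grid point makes four errors below
   [eta / 4]: the slope and the jump [e n] of [f n], the distance at the grid point, and the slope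
   of [gamma]. *)
pose k := (Num.bound (L / (eta / 4))).+1.
have kL : L / k%:R < eta / 4.
  rewrite ltr_pdivrMr ?ltr0n// mulrC -ltr_pdivrMr//.
  apply: (@lt_le_trans _ _ (Num.bound (L / (eta / 4)))%:R); last by rewrite ler_nat.
  by rewrite archi_boundP// divr_ge0// ltW.
have grid N : U [set n | forall j, (j < N)%N ->
    mdist (f n (j%:R / k%:R)) (gamma (j%:R / k%:R)) < eta / 4].
  elim: N => [|N ih]; first by apply: filterS filterT => n _ j.
  apply: filterS2 ih (hg (N%:R / k%:R) _ eta4) => n ih nN j.
  by rewrite ltnS leq_eqVlt => /predU1P[->|/ih].
have /Uex[n [[/= mn en] hn]] := UI _ _ (small _ m eta4) (grid k.+1).
exists n => // t /andP[t0 t1].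
have k0 : 0 < k%:R :> R by rewrite ltr0n.
have tk0 : 0 <= t * k%:R by rewrite mulr_ge0// ltW.
pose j := Num.truncn (t * k%:R).
have /andP[j1 j2] := truncn_itv tk0; rewrite -/j in j1 j2.
have jk : (j < k.+1)%N.
  by rewrite ltnS -(ler_nat R) (le_trans j1)// ler_piMl// ltW.
have s01 : 0 <= (j%:R / k%:R : R) <= 1.
  by rewrite divr_ge0//= ler_pdivrMr// mul1r ler_nat -ltnS.
have ts : L * `|t - j%:R / k%:R| <= L / k%:R.
  rewrite ler_wpM2l// ger0_norm; last by rewrite subr_ge0 ler_pdivrMr.
  rewrite -(ler_pM2r k0) mulVf ?gt_eqF// mulrBl divfK ?gt_eqF//.
  by move: j2; rewrite -natr1; lra.
have t01 : 0 <= t <= 1 by rewrite t0.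
have := metric_triangle (f n t) (f n (j%:R / k%:R)) (gamma t).
have := metric_triangle (f n (j%:R / k%:R)) (gamma (j%:R / k%:R)) (gamma t).
have := hn j jk; have := lip n _ _ t01 s01.
by have := glip _ _ s01 t01; rewrite (distrC (j%:R / k%:R)); lra.
Qed.

End LimitCurve.

(** * Morrey's inequality for continuous functions *)

Section Mean.
Context {R : realType} {X : pmetricType R}.
Variable mu : {outer_measure set X -> \bar R}.
Notation cmu := (caratheodory_type mu).

Lemma mean_dist (B : set X) (w : X -> R) (c M : R) :
  measurable (B : set cmu) -> (0 < mu B < +oo)%E ->
  (cara mu).-integrable B (EFin \o w) ->
  (\int[cara mu]_(x in B) `|w x - c|%:E <= M%:E)%E ->
  `|mean mu B w - c| <= (fine (mu B))^-1 * M.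
Proof.
move=> mB /andP[B0 Boo] iw le.
have m0 : 0 < fine (mu B) by rewrite fine_gt0// B0.
have ic : (cara mu).-integrable B (EFin \o (fun=> c)).
  apply: measurable_bounded_integrable => //; exists `|c|; split => // M' cM x _ /=.
  exact: ltW.
have -> : mean mu B w - c = (fine (mu B))^-1 * \int[cara mu]_(x in B) (w x - c).
  rewrite RintegralB// Rintegral_cst// mulrBr [X in _ = _ - X]mulrC.
  by rewrite mulfK ?gt_eqF.
rewrite normrM gtr0_norm ?invr_gt0// ler_pM2l ?invr_gt0//.
have iwc : (cara mu).-integrable B (EFin \o (fun x => w x - c)).
  by have := integrableB mB iw ic.
apply: (le_trans (le_normr_Rintegral mB iwc)).
rewrite -lee_fin /Rintegral fineK//.
rewrite ge0_fin_numE; first exact: (le_lt_trans le (ltry _)).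
by apply: integral_ge0 => x _; rewrite lee_fin.
Qed.

Lemma integral_dist_le (B : set X) (w : X -> R) (c e : R) :
  measurable (B : set cmu) -> (mu B < +oo)%E ->
  (cara mu).-integrable B (EFin \o w) -> (forall x, B x -> `|w x - c| <= e) ->
  (\int[cara mu]_(x in B) `|w x - c|%:E <= (e * fine (mu B))%:E)%E.
Proof.
move=> mB Boo iw le.
have mE : mu B = (fine (mu B))%:E by rewrite fineK// ge0_fin_numE.
rewrite EFinM -mE -(integral_cst (cara mu) mB); apply: ge0_le_integral => //.
  have /integrableP[mw _] := iw; apply/measurable_EFinP; apply: measurableT_comp => //.
  by apply: measurable_funB => //; exact/measurable_EFinP.
Qed.

Lemma mean_dist_le (B : set X) (w : X -> R) (c e : R) :
  measurable (B : set cmu) -> (0 < mu B < +oo)%E ->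
  (cara mu).-integrable B (EFin \o w) -> (forall x, B x -> `|w x - c| <= e) ->
  `|mean mu B w - c| <= e.
Proof.
move=> mB /[dup] B0oo /andP[B0 Boo] iw le.
apply: (le_trans (mean_dist mB B0oo iw (integral_dist_le mB Boo iw le))).
by rewrite mulrC mulfK// gt_eqF// fine_gt0// B0.
Qed.

End Mean.

Section Morrey.
Context {R : realType} {X : pmetricType R}.
Variables (Q p : R) (mu : {outer_measure set X -> \bar R}).
Notation cmu := (caratheodory_type mu).
Hypotheses (Q0 : 0 < Q) (Qp : Q < p).
Hypothesis borel_cara : <<s @open X >> `<=` mu.-caratheodory.
Hypothesis ahlfors : ahlfors_regular Q mu.
Hypothesis poincare : poincare_inequality p mu.

Let p0 : 0 < p. Proof. exact: lt_trans Qp. Qed.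
Let p_neq0 : p != 0. Proof. by rewrite gt_eqF. Qed.
Let a := 1 - Q / p.
Let a0 : 0 < a. Proof. by rewrite subr_gt0 ltr_pdivrMr// mul1r. Qed.

Let mball x r : measurable (ball x r : set cmu).
Proof. exact: (open_cara borel_cara (metric_ball_open x r)). Qed.

(** The exponent is that of [r * (r^Q)^(-1/p)], the scaling of the right-hand side of Poincare's
    inequality. The smaller ball need not be concentric: [z = x] serves the telescoping, and another
    centre serves the passage between two points. *)
Lemma mean_ball_dist : exists2 C : R, 0 < C &
  forall (w : X -> R) g N, integrable_on_balls mu w -> upper_gradient g w -> 0 <= N ->
    (\int[cara mu]_x (g x `^ p) <= (N `^ p)%:E)%E ->
    forall x z r, 0 < r -> ball z (r / 2) `<=` ball x r ->
      `|mean mu (ball z (r / 2)) w - mean mu (ball x r) w| <= C * r `^ a * N.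
Proof.
have [A A1 hA] := ahlfors; have [finb [K [lam [K0 lam1 hP]]]] := poincare.
have A0 : 0 < A by exact: lt_le_trans A1.
(* [A ^+ 2 * 2]^ Q[bounds the ratio of the measures of the two
   balls,]K[is Poincare's constant, and]A [^ p^-1] comes from the lower bound [r^Q / A] for the
   measure of the dilated ball, valid as [lam >= 1]. *)
exists (A ^+ 2 * 2 `^ Q * K * A `^ p^-1).
  by rewrite !mulr_gt0// ?powR_gt0// exprn_gt0.
move=> w g N iw ug N0 gN x z r r0 zx.
have r20 : 0 < r / 2 by rewrite divr_gt0.
have rQ : 0 < r `^ Q by rewrite powR_gt0.
have fmE y s : 0 < s -> mu (ball y s) = (fine (mu (ball y s)))%:E.
  by move=> s0; rewrite fineK// ge0_fin_numE//; case/andP: (finb y s s0).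
have fm_le y s : 0 < s -> s `^ Q / A <= fine (mu (ball y s)) <= A * s `^ Q.
  by move=> s0; have := hA y s s0; rewrite fmE// !lee_fin.
have fm0 y s : 0 < s -> 0 < fine (mu (ball y s)).
  by move=> s0; rewrite fine_gt0//; exact: finb.
set mr := fine (mu (ball x r)); set ms := fine (mu (ball z (r / 2))).
have mr0 : 0 < mr by exact: fm0.
have ms0 : 0 < ms by exact: fm0.
pose c := mean mu (ball x r) w.
have mg : measurable_fun setT ((fun y => g y `^ p)%E : cmu -> \bar R).
  case: ug => mg _ _.
  apply: (measurableT_comp (measurable_poweR _)).
  exact: (borel_measurable_fun borel_cara).
have P : ((\int[cara mu]_(y in ball x r) `|w y - c|%:E) <=
    (mr * (K * r * (A * r `^ (- Q) * N `^ p) `^ p^-1))%:E)%E.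
  have lamr0 : 0 < lam * r by rewrite mulr_gt0// (lt_le_trans ltr01).
  have := hP w g iw ug x r r0; rewrite -/mr -/c => h.
  have {}h : ((mr^-1)%:E * (\int[cara mu]_(y in ball x r) `|w y - c|%:E) <=
      (K * r * (A * r `^ (- Q) * N `^ p) `^ p^-1)%:E)%E.
    apply: (le_trans h); rewrite [leRHS]EFinM lee_pmul2l ?lte_fin ?mulr_gt0//.
    rewrite -poweR_EFin; apply: gt0_ler_poweR.
    - by rewrite invr_ge0 ltW.
    - rewrite in_itv /= leey andbT mule_ge0//.
        by rewrite lee_fin invr_ge0 ltW// fm0.
      by apply: integral_ge0 => y _; exact: poweR_ge0.
    - by rewrite in_itv /= leey andbT lee_fin !mulr_ge0 ?powR_ge0// ltW.
    rewrite EFinM; apply: lee_pmul.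
    - by rewrite lee_fin invr_ge0 ltW// fm0.
    - by apply: integral_ge0 => y _; exact: poweR_ge0.
    - rewrite lee_fin powRN -[A]invrK -invfM lef_pV2 ?posrE ?fm0//; last first.
        by rewrite mulr_gt0// invr_gt0.
      rewrite mulrC; have /andP[+ _] := fm_le x _ lamr0; apply: le_trans.
      rewrite ler_pM2r ?invr_gt0//; apply: ge0_ler_powR; rewrite ?nnegrE; try exact: ltW.
      by rewrite ler_peMl// ltW.
    apply: le_trans gN; apply: ge0_subset_integral => //.
    by move=> y _; exact: poweR_ge0.
  rewrite EFinM; apply: le_trans (lee_wpmul2l _ h); last by rewrite lee_fin ltW.
  by rewrite muleA -EFinM mulfV ?gt_eqF// mul1e.
have P2 : ((\int[cara mu]_(y in ball z (r / 2)) `|w y - c|%:E) <=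
    (mr * (K * r * (A * r `^ (- Q) * N `^ p) `^ p^-1))%:E)%E.
  apply: le_trans P; apply: ge0_subset_integral => //.
  have /integrableP[mw _] := iw x r r0; apply/measurable_EFinP; apply: measurableT_comp => //.
  by apply: measurable_funB => //; exact/measurable_EFinP.
apply: (le_trans (mean_dist (mball z (r / 2)) _ (iw z _ r20) P2)); first exact: finb.
rewrite -/ms.
have -> : K * r * (A * r `^ (- Q) * N `^ p) `^ p^-1 = K * A `^ p^-1 * r `^ a * N.
  rewrite !powRM ?mulr_ge0 ?powR_ge0 ?(ltW A0)// -!powRrM mulfV// powRr1//.
  rewrite /a powRD ?gt_eqF ?implybT// powRr1 ?(ltW r0)// mulNr; ring.
have mrs : ms^-1 * mr <= A ^+ 2 * 2 `^ Q.
  rewrite mulrC ler_pdivrMr//.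
  have /andP[_ h1] := fm_le x r r0; have /andP[h2 _] := fm_le z _ r20.
  apply: (le_trans h1); apply: (@le_trans _ _ (A ^+ 2 * 2 `^ Q * ((r / 2) `^ Q / A))).
    rewrite le_eqVlt; apply/orP; left; apply/eqP.
    have -> : r `^ Q = 2 `^ Q * (r / 2) `^ Q.
      by rewrite -powRM ?ltW// mulrC divfK.
    by field; rewrite gt_eqF.
  by rewrite ler_wpM2l// mulr_ge0 ?powR_ge0// exprn_ge0// ltW.
rewrite mulrA; apply: (@le_trans _ _ (A ^+ 2 * 2 `^ Q * (K * A `^ p^-1 * r `^ a * N))).
  by rewrite ler_wpM2r// !mulr_ge0 ?powR_ge0// ltW.
by rewrite !mulrA.
Qed.

Lemma mean_ball_cvg (w : X -> R) x e : integrable_on_balls mu w -> continuous w ->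
  0 < e -> exists2 d, 0 < d & forall r, 0 < r -> r <= d ->
    `|mean mu (ball x r) w - w x| <= e.
Proof.
move=> iw cw e0; have [finb _] := poincare.
have /cvgrPdist_lt /(_ e e0) /nbhs_ballP[d /= d0 hd] := cw x.
exists d => // r r0 rd; apply: mean_dist_le.
- exact: mball.
- exact: finb.
- exact: iw.
move=> y xy; rewrite distrC ltW//; apply: hd.
by move: xy; rewrite !ballEmdist /= => /lt_le_trans; exact.
Qed.

Lemma morrey : exists2 C : R, 0 < C &
  forall (w : X -> R) g N, continuous w -> integrable_on_balls mu w ->
    upper_gradient g w -> 0 <= N ->
    (\int[cara mu]_x (g x `^ p) <= (N `^ p)%:E)%E ->
    forall x y, `|w x - w y| <= C * mdist x y `^ a * N.
Proof.
have [C C0 hC] := mean_ball_dist.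
pose q : R := 2^-1 `^ a.
have q0 : 0 < q by rewrite powR_gt0// invr_gt0.
have q1 : q < 1.
  have -> : 1 = 1 `^ a :> R by rewrite powR1.
  by apply: gt0_ltr_powR => //; rewrite ?nnegrE ?invr_ge0//; lra.
have q1' : 0 < 1 - q by rewrite subr_gt0.
have [C2 C20 CE] : exists2 C2, 0 < C2 & C = C2 * (1 - q).
  by exists (C / (1 - q)); rewrite ?divr_gt0// divfK// gt_eqF.
(* With D = d(x, y), the three contributions are telescoping at [x] from radius 2D, passing from
   [ball x (2 * D)] to [ball y D], and telescoping at [y] from radius D. *)
exists ((C2 + C) * 2 `^ a + C2); first by rewrite addr_gt0// mulr_gt0 ?addr_gt0 ?powR_gt0.
move=> w g N cw iw ug N0 gN.
have tele x r : 0 < r -> `|w x - mean mu (ball x r) w| <= C2 * r `^ a * N.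
  move=> r0; pose r_ n := r / 2 ^+ n.
  have r_0 n : 0 < r_ n by rewrite divr_gt0// exprn_gt0.
  have r_S n : r_ n.+1 = r_ n / 2 by rewrite /r_ exprS; field.
  have r_q n : r_ n `^ a = r `^ a * q ^+ n.
    elim: n => [|n ih]; first by rewrite /r_ expr0 divr1 mulr1.
    by rewrite r_S powRM ?invr_ge0// ?ltW// ih exprSr mulrA.
  (* The partial sums of the geometric series of ratio [q] are kept in closed form, which is why [C]
     was written as [C2 * (1 - q)]. *)
  have H n : `|mean mu (ball x (r_ n)) w - mean mu (ball x r) w| <=
      C2 * r `^ a * N * (1 - q ^+ n).
    elim: n => [|n ih]; first by rewrite /r_ expr0 divr1 !subrr normr0 mulr0.
    have sub : ball x (r_ n / 2) `<=` ball x (r_ n).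
      by apply: le_ball; rewrite ler_pdivrMr// ler_peMr// ?ler1n// ltW.
    have := hC w g N iw ug N0 gN x x (r_ n) (r_0 n) sub; rewrite -r_S r_q => h.
    have := ler_distD (mean mu (ball x (r_ n)) w) (mean mu (ball x (r_ n.+1)) w)
      (mean mu (ball x r) w).
    have -> : C2 * r `^ a * N * (1 - q ^+ n.+1) =
      C * (r `^ a * q ^+ n) * N + C2 * r `^ a * N * (1 - q ^+ n).
      by rewrite CE exprS; ring.
    by lra.
  have D0 : 0 <= C2 * r `^ a * N by rewrite !mulr_ge0 ?powR_ge0// ltW.
  apply/ler_addgt0Pr => e e0.
  have [d d0 hd] := mean_ball_cvg x iw cw e0.
  have [n rn] : exists n, r_ n <= d.
    exists (Num.bound (r / d)); rewrite ler_pdivrMr ?exprn_gt0// mulrC -ler_pdivrMr//.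
    apply: (@le_trans _ _ (Num.bound (r / d))%:R).
      by rewrite ltW// archi_boundP// divr_ge0// ltW.
    by rewrite -natrX ler_nat ltnW// ltn_expl.
  have h1 := hd _ (r_0 n) rn; have h2 := H n.
  have := ler_distD (mean mu (ball x (r_ n)) w) (w x) (mean mu (ball x r) w).
  rewrite (distrC (w x) (mean mu (ball x (r_ n)) w)).
  have : C2 * r `^ a * N * (1 - q ^+ n) <= C2 * r `^ a * N.
    by rewrite ler_piMr// gerBl exprn_ge0// ltW.
  by lra.
move=> x y; have [->|xy] := eqVneq x y.
  by rewrite subrr normr0 mulr_ge0// mulr_ge0 ?powR_ge0// addr_ge0
    ?mulr_ge0 ?powR_ge0 ?addr_ge0// ltW.
set D := mdist x y; have D0 : 0 < D by rewrite mdist_gt0.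
have D20 : 0 < 2 * D by rewrite mulr_gt0.
have DE : 2 * D / 2 = D by field.
have h1 := tele x _ D20; have h2 := tele y _ D0.
have h3 := hC w g N iw ug N0 gN x y (2 * D) D20.
rewrite DE in h3; have {}h3 := h3 _.
have {}h3 : `|mean mu (ball y D) w - mean mu (ball x (2 * D)) w| <= C * (2 * D) `^ a * N.
  apply: h3 => z; rewrite !ballEmdist /= => yz.
  by have := metric_triangle x y z; rewrite -/D; lra.
have powE : (2 * D) `^ a = 2 `^ a * D `^ a by rewrite powRM// ltW.
rewrite powE in h1 h3.
have := ler_distD (mean mu (ball x (2 * D)) w) (w x) (w y).
have := ler_distD (mean mu (ball y D) w) (mean mu (ball x (2 * D)) w) (w y).
rewrite (distrC (mean mu (ball x (2 * D)) w) (mean mu (ball y D) w)).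
by rewrite (distrC (mean mu (ball y D) w) (w y)); lra.
Qed.

End Morrey.

(** * Lower envelopes and chains *)

Section Envelope.
Context {R : realType} {X : pmetricType R}.
Variable g : X -> \bar R.
Hypothesis g0 : forall x, (0 <= g x)%E.

(* The lower envelope of [g] at scale [e], truncated at height [1/e]. *)
Definition envelope (e : R) (z : X) : R :=
  fine (mine (e^-1)%:E (ereal_inf [set g y | y in ball z e])).

Lemma envelopeE e z : 0 < e ->
  (envelope e z)%:E = mine (e^-1)%:E (ereal_inf [set g y | y in ball z e]).
Proof.
move=> e0; rewrite fineK// ge0_fin_numE.
  by rewrite (@le_lt_trans _ _ (e^-1)%:E) ?ltry// ge_min lexx.
rewrite le_min lee_fin invr_ge0 ltW//=.
by apply: le_ereal_inf_tmp => _ [y _ <-].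
Qed.

Lemma envelope_ge0 e z : 0 < e -> 0 <= envelope e z.
Proof.
move=> e0; rewrite -lee_fin envelopeE// le_min lee_fin invr_ge0 ltW//=.
by apply: le_ereal_inf_tmp => _ [y _ <-].
Qed.

Lemma envelope_le_inv e z : 0 < e -> envelope e z <= e^-1.
Proof. by move=> e0; rewrite -lee_fin envelopeE// ge_min lexx. Qed.

Lemma envelope_le e z y : 0 < e -> ball z e y -> ((envelope e z)%:E <= g y)%E.
Proof.
move=> e0 zy; rewrite envelopeE// ge_min; apply/orP; right.
by apply: ereal_inf_lbound; exists y.
Qed.

Lemma le_envelope e z c : 0 < e -> c <= e^-1 ->
  (forall y, ball z e y -> (c%:E <= g y)%E) -> c <= envelope e z.
Proof.
move=> e0 ce h; rewrite -lee_fin envelopeE// le_min lee_fin ce /=.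
by apply: le_ereal_inf_tmp => _ [y zy <-]; exact: h.
Qed.

Lemma envelope_mono e z e' z' : 0 < e' -> e' <= e -> ball z' e' `<=` ball z e ->
  envelope e z <= envelope e' z'.
Proof.
move=> e'0 ee' sub; have e0 := lt_le_trans e'0 ee'.
apply: le_envelope => // [|y /sub]; last exact: envelope_le.
by rewrite (le_trans (envelope_le_inv _ e0))// lef_pV2 ?posrE.
Qed.

(** A value below [a] is either forced by the truncation or witnessed by one [y], which stays within
    [e] of all points close to [z]. This gives Borel measurability of the envelope. *)
Lemma envelope_usc e a : 0 < e -> open [set z | envelope e z < a].
Proof.
move=> e0; rewrite openE => z /= za.
rewrite -lte_fin envelopeE// gt_min in za; case/orP: za => [ea|].
  by apply: nearW => y /=; rewrite (le_lt_trans (envelope_le_inv y e0)) -?lte_fin.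
move=> /ereal_inf_lt[_ [y zy <-] gy].
have oy : open (ball y e) := metric_ball_open y e.
have /open_nbhs_nbhs : open_nbhs z (ball y e) by split => //; exact: ball_sym.
apply: filterS => t yt /=; rewrite -lte_fin; apply: le_lt_trans gy.
by apply: envelope_le => //; exact: ball_sym.
Qed.

Lemma envelope_cvg z : (forall a, open [set x | (a < g x)%E]) ->
  (envelope k.+1%:R^-1 z)%:E @[k --> \oo] --> g z.
Proof.
move=> lsc.
have e0 k : 0 < k.+1%:R^-1 :> R by rewrite invr_gt0.
have mono : nondecreasing_seq (fun k => (envelope k.+1%:R^-1 z)%:E).
  apply/nondecreasing_seqP => k; rewrite lee_fin.
  have le : k.+2%:R^-1 <= k.+1%:R^-1 :> R by rewrite lef_pV2 ?posrE// ler_nat.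
  by apply: envelope_mono => //; exact: le_ball.
have cv := ereal_nondecreasing_cvgn mono.
suff <- : ereal_sup (range (fun k => (envelope k.+1%:R^-1 z)%:E)) = g z by [].
apply/eqP; rewrite eq_le; apply/andP; split.
  by apply: ge_ereal_sup => _ [k _ <-]; apply: envelope_le => //; exact: ballxx.
rewrite leNgt; apply/negP => lt.
have [c c0 [cS cg]] : exists2 c : R, 0 <= c &
    (ereal_sup (range (fun k => (envelope k.+1%:R^-1 z)%:E)) < c%:E)%E /\ (c%:E < g z)%E.
  set S := ereal_sup _ in lt *.
  have S0 : (0 <= S)%E.
    by apply: (@le_trans _ _ (envelope 0.+1%:R^-1 z)%:E);
      [rewrite lee_fin envelope_ge0|apply: ereal_sup_ubound; exists 0%N].
  case: S S0 lt => [s||] //= s0; case: (g z) => [b||] //= sb.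
    rewrite lte_fin in sb.
    by exists ((s + b) / 2); rewrite ?lte_fin; [rewrite lee_fin in s0; lra|split; lra].
  by exists (s + 1); rewrite ?lte_fin ?ltry ?ltrDl//; rewrite lee_fin in s0; lra.
have /nbhs_ballP[d /= d0 hd] : nbhs z [set x | (c%:E < g x)%E].
  by apply: open_nbhs_nbhs; split => //; exact: lsc.
(* Large enough for two purposes: the truncation at height [k.+1] is above [c], and the ball of
   radius [1 / k.+1] lies where [g > c]. *)
pose k := Num.bound (c + d^-1).
have kb : c + d^-1 < k.+1%:R.
  apply: (@lt_le_trans _ _ k%:R); last by rewrite ler_nat.
  by rewrite archi_boundP// addr_ge0// invr_ge0 ltW.
move: cS; apply/negP; rewrite -leNgt.
apply: (@le_trans _ _ (envelope k.+1%:R^-1 z)%:E); last by apply: ereal_sup_ubound; exists k.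
rewrite lee_fin; apply: le_envelope => //.
  by rewrite invrK ltW// (le_lt_trans _ kb)// lerDl invr_ge0 ltW.
move=> y zy; apply: ltW; apply: hd; apply: le_ball zy.
by rewrite invf_ple ?posrE// ltW// (le_lt_trans _ kb)// lerDr.
Qed.

End Envelope.

Section BorelFunctions.
Context {R : realType} {X : pmetricType R}.

Lemma usc_borel (f : X -> R) : (forall a, open [set x | f x < a]) ->
  measurable_fun setT (f : g_sigma_algebraType (@open X) -> R).
Proof.
move=> usc; apply: (measurability _ (RGenInftyO.measurableE R)) => _ [_ [a ->] <-].
rewrite setTI; apply: sub_sigma_algebra.
rewrite (_ : _ @^-1` _ = [set x | f x < a]); first exact: usc.
by apply/seteqP; split => x /=; rewrite in_itv.
Qed.

Lemma lsc_borel (f : X -> \bar R) : (forall a, open [set x | (a < f x)%E]) ->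
  measurable_fun setT (f : g_sigma_algebraType (@open X) -> \bar R).
Proof.
move=> lsc; apply: (measurability _ (ErealGenOInfty.measurableE R)) => _ [_ [a ->] <-].
rewrite setTI; apply: sub_sigma_algebra.
rewrite (_ : _ @^-1` _ = [set x | (a%:E < f x)%E]); first exact: lsc.
by apply/seteqP; split => x /=; rewrite in_itv /= andbT.
Qed.

Lemma continuous_borel (f : X -> R) : continuous f ->
  measurable_fun setT (f : g_sigma_algebraType (@open X) -> R).
Proof.
move=> /continuousP cf; apply: usc_borel => a.
rewrite (_ : [set _ | _] = f @^-1` [set y | y < a]); last by [].
by apply: cf; exact: open_lt.
Qed.

End BorelFunctions.

(** * Discrete chains and their minimal cost *)

Section Chains.
Context {R : realType} {X : pmetricType R}.
Variables (e : R) (G : X -> R) (x : X).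
Hypotheses (e0 : 0 < e) (G0 : forall z, 0 <= G z).

(* [chain z l c]: some chain of steps shorter than [e] from [x] to [z] has
   length [l] and cost [c], a step from [z] to [z'] costing [G z * mdist z z']. *)
Inductive chain : X -> R -> R -> Prop :=
| chain_nil : chain x 0 0
| chain_rcons z z' l c : chain z l c -> mdist z z' < e ->
    chain z' (l + mdist z z') (c + G z * mdist z z').

Lemma chain_ge0 z l c : chain z l c -> 0 <= l /\ 0 <= c.
Proof.
elim=> // z1 z2 l1 c1 _ [l0 c0] _.
by rewrite !addr_ge0 ?mulr_ge0 ?mdist_ge0.
Qed.

Lemma chain_dist z l c : chain z l c -> mdist x z <= l.
Proof.
elim=> [|z1 z2 l1 c1 _ ih _]; first by rewrite mdistxx.
by apply: (le_trans (metric_triangle _ z1 _)); rewrite lerD2r.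
Qed.

(** A bootstrap along the chain: the part already covered has length at most [A / m], so it ends
    within [K - e] of [x], where the weight is at least [m]; the next step therefore costs at least
    [m] times its length. *)
Lemma chain_length (m K A : R) z l c : 0 < m -> A / m + e <= K ->
  (forall y, mdist x y <= K - e -> m <= G y) ->
  chain z l c -> c <= A -> m * l <= c.
Proof.
move=> m0 AK hG; elim=> [|z1 z2 l1 c1 h ih _] cA; first by rewrite mulr0.
have c1A : c1 <= A.
  by apply: le_trans cA; rewrite lerDl mulr_ge0// mdist_ge0.
rewrite mulrDr lerD// ?ih// ler_wpM2r ?mdist_ge0//; apply: hG.
apply: (le_trans (chain_dist h)).
apply: (@le_trans _ _ (A / m)); last by lra.
by rewrite ler_pdivlMr// mulrC (le_trans (ih c1A)).
Qed.

(** The cap [T] keeps the infimum meaningful when no chain reaches [z], and it makes the function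
    bounded, hence integrable on balls once it is continuous. A value strictly below [T] is what
    proves that a chain exists. *)
Definition chain_cost (T : R) (z : X) : R :=
  inf [set c | c = T \/ exists l, chain z l c].

Section Cost.
Variable T : R.
Hypothesis T0 : 0 <= T.

Let lb z : lbound [set c | c = T \/ exists l, chain z l c] 0.
Proof. by move=> c [->//|[l /chain_ge0[]]]. Qed.

Let hasinf z : has_inf [set c | c = T \/ exists l, chain z l c].
Proof. by split; [exists T; left|exists 0; exact: lb]. Qed.

Lemma chain_cost_ge0 z : 0 <= chain_cost T z.
Proof. by apply: lb_le_inf; [case: (hasinf z)|exact: lb]. Qed.

Lemma chain_cost_le z : chain_cost T z <= T.
Proof. by apply: ge_inf; [case: (hasinf z)|left]. Qed.

Lemma chain_cost0 : chain_cost T x = 0.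
Proof.
apply/eqP; rewrite eq_le chain_cost_ge0 andbT.
apply: ge_inf; first by case: (hasinf x).
by right; exists 0; exact: chain_nil.
Qed.

Lemma chain_cost_lt z c : chain_cost T z < c -> c <= T ->
  exists l c', chain z l c' /\ c' < c.
Proof.
move=> /(inf_lt (hasinf z).1)[c' /= [->|[l h]] c'c cT].
  by move: c'c; rewrite ltNge cT.
by exists l, c'.
Qed.

Lemma chain_cost_step z z' : mdist z z' < e ->
  chain_cost T z' <= chain_cost T z + G z * mdist z z'.
Proof.
move=> zz'; rewrite -lerBlDr; apply: lb_le_inf; first by case: (hasinf z).
have d0 : 0 <= G z * mdist z z' by rewrite mulr_ge0// mdist_ge0.
move=> c [->|[l h]]; rewrite lerBlDr.
  by apply: (le_trans (chain_cost_le z')); rewrite lerDl.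
apply: ge_inf; first by case: (hasinf z').
by right; exists (l + mdist z z'); exact: chain_rcons.
Qed.

(** At distances below [e] a single step in either direction bounds the variation by [M] times the
    distance. For an envelope, the truncation supplies [M = e^-1]. *)
Lemma chain_cost_continuous M : (forall z, G z <= M) -> continuous (chain_cost T).
Proof.
move=> GM z; apply/cvgrPdist_lt => d d0.
have M0 : 0 <= M by exact: le_trans (GM z).
have M1 : 0 < M + 1 by rewrite ltr_wpDl.
apply/nbhs_ballP; exists (Num.min e (d / (M + 1))) => /=.
  by rewrite lt_min e0 divr_gt0.
move=> y; rewrite ballEmdist /= lt_min => /andP[zye].
rewrite ltr_pdivlMr// => zyd.
have h1 := chain_cost_step zye.
have h2 := @chain_cost_step y z; rewrite metric_sym in h2; have {}h2 := h2 zye.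
have := mdist_ge0 z y; have := GM z; have := GM y; have := G0 z; have := G0 y.
rewrite ltr_distl => *; apply/andP; split; nra.
Qed.

End Cost.

End Chains.

Section ChainFunctions.
Context {R : realType} {X : pmetricType R}.
Notation leb := (@lebesgue_measure R).

Lemma measurable_arclength_comp (gamma : R -> X) a b (rho : X -> \bar R) :
  rectifiable_curve gamma a b ->
  measurable_fun setT (rho : g_sigma_algebraType (@open X) -> \bar R) ->
  measurable_fun `[0%R, fine (curve_length gamma a b)]
    (rho \o arclength_param gamma a b).
Proof.
move=> rect mrho; apply: measurable_fun_within_comp => //.
apply: (@lip_within_continuous _ _ _ _ 1) => // s t; rewrite /= !in_itv /= => hs ht.
by rewrite mul1r; exact: arclength_param_lip.
Qed.

(** Arc length bounds distance, so on a piece of curve shorter than [e] the cost grows by at most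
    the envelope at one endpoint times the length, and that envelope lies below [g] on the whole
    piece. The upper gradient is [g] itself, independently of the scale [e]. *)
Lemma chain_cost_upper_gradient (g : X -> \bar R) (e T : R) (x : X) :
  (forall y, (0 <= g y)%E) -> 0 < e -> 0 <= T ->
  measurable_fun setT (g : g_sigma_algebraType (@open X) -> \bar R) ->
  upper_gradient g (chain_cost e (envelope g e) x T).
Proof.
move=> g0 e0 T0 mg; split => // a b gamma rect.
have G0 z := envelope_ge0 g0 z e0.
set w := chain_cost e _ x T.
set l := fine (curve_length gamma a b).
pose s := arclength_param gamma a b.
have l0 : 0 <= l := arclen_ge0 rect.
have mh := measurable_arclength_comp rect mg.
have slip := arclength_param_lip rect.
have loc r t q : 0 <= r <= l -> 0 <= t <= l -> 0 <= q <= l -> `|t - r| < e ->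
    `|q - r| < e ->
    w (s t) - w (s r) <= envelope g e (s r) * `|t - r| /\
    ((envelope g e (s r))%:E <= g (s q))%E.
  move=> hr ht hq tr qr.
  have d1 : mdist (s r) (s t) <= `|t - r| by rewrite distrC; exact: slip.
  have d2 : mdist (s r) (s q) <= `|q - r| by rewrite distrC; exact: slip.
  split; last by apply: envelope_le => //; rewrite ballEmdist /= (le_lt_trans d2).
  have := @chain_cost_step _ _ e _ x G0 T T0 (s r) (s t) (le_lt_trans d1 tr).
  have : envelope g e (s r) * mdist (s r) (s t) <= envelope g e (s r) * `|t - r|.
    by rewrite ler_wpM2l.
  by rewrite -/w; lra.
have <- : s 0 = gamma a by exact: arclength_param0.
have <- : s l = gamma b by exact: arclength_param_end.
have h1 : ((w (s l) - w (s 0))%:E <= \int[leb]_(r in `[0%R, l]) g (s r))%E.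
  apply: (@increment_le_integral _ (w \o s) (g \o s) l e) => //=.
  move=> r t r0 rt tl tre; exists (envelope g e (s r)).
  have hr : 0 <= r <= l by rewrite r0 (le_trans rt).
  have ht : 0 <= t <= l by rewrite tl (le_trans r0).
  have trE : `|t - r| = t - r by rewrite ger0_norm// subr_ge0.
  have tre' : `|t - r| < e by rewrite trE.
  split => //; first by have [] := loc r t t hr ht ht tre' tre'; rewrite trE.
  move=> q /andP[rq qt].
  have hq : 0 <= q <= l by rewrite (le_trans r0)//= (le_trans qt).
  have [] // := loc r t q hr ht hq tre'.
  by rewrite ger0_norm ?subr_ge0//; lra.
(* For the opposite sign the chain steps backwards along the curve, so the envelope is evaluated at
   the right endpoint. *)
have h2 : ((- w (s l) - - w (s 0))%:E <= \int[leb]_(r in `[0%R, l]) g (s r))%E.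
  apply: (@increment_le_integral _ (fun t => - w (s t)) (g \o s) l e) => //=.
  move=> r t r0 rt tl tre; exists (envelope g e (s t)).
  have hr : 0 <= r <= l by rewrite r0 (le_trans rt).
  have ht : 0 <= t <= l by rewrite tl (le_trans r0).
  have trE : `|r - t| = t - r by rewrite distrC ger0_norm// subr_ge0.
  have tre' : `|r - t| < e by rewrite trE.
  split => //.
    by have [] := loc t r r ht hr hr tre' tre'; rewrite trE; lra.
  move=> q /andP[rq qt].
  have hq : 0 <= q <= l by rewrite (le_trans r0)//= (le_trans qt).
  have [] // := loc t r q ht hr hq tre'.
  by rewrite distrC ger0_norm ?subr_ge0//; lra.
rewrite /line_integral -/l -/s.
case: (ger0P (w (s 0) - w (s l))) => _; last by rewrite opprB; exact: h1.
by have -> : w (s 0) - w (s l) = - w (s l) - - w (s 0) by ring.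
Qed.

(* The piecewise constant curve that spends time [k * mdist z z'] at [z] when the
   chain steps from [z] to [z']. *)
Lemma chain_step_function (e k : R) (G : X -> R) (x z : X) (l c : R) :
  0 < e -> 0 < k -> (forall y, 0 <= G y) -> chain e G x z l c ->
  exists f : R -> X, [/\ forall t, 0 <= t -> k * mdist x (f t) <= t,
    forall t, mdist x (f t) <= l,
    forall t, k * l < t -> f t = z,
    forall s t, 0 <= s -> s <= t -> k * mdist (f s) (f t) <= t - s + k * e &
    [/\ forall s, 0 <= s -> s <= k * l -> k * mdist (f s) z <= k * l - s + k * e,
      forall h : X -> R, measurable_fun setT (h \o f) &
      (\int[leb]_(t in `[0%R, (k * l)%R]) (G (f t))%:E = (k * c)%:E)%E]].
Proof.
move=> e0 k0 G0 ch.
have ke0 : 0 <= k * e by rewrite mulr_ge0// ltW.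
elim: ch => [|z1 z2 l1 c1 ch [f [f1 f2 f3 f4 [f5 f6 f7]]] d].
  exists (fun=> x); split => //.
  - by move=> t t0; rewrite mdistxx mulr0.
  - by move=> t; rewrite mdistxx.
  - by move=> s t s0 st; rewrite mdistxx mulr0 addr_ge0 ?subr_ge0.
  split => //.
  - move=> s s0; rewrite mdistxx !mulr0 => sl.
    by rewrite addr_ge0 ?subr_ge0.
  - by move=> h; exact: measurable_cst.
  - by rewrite !mulr0 set_itv1 integral_set1.
have [l0 c0] := chain_ge0 G0 ch.
have D0 := mdist_ge0 z1 z2; set D := mdist z1 z2 in d D0 *.
have kD0 : 0 <= k * D by rewrite mulr_ge0// ltW.
have kl0 : 0 <= k * l1 by rewrite mulr_ge0// ltW.
have kde : k * D <= k * e by rewrite ler_wpM2l// ltW.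
have xz1 := chain_dist ch.
have xz2 : mdist x z2 <= l1 + D.
  by have := metric_triangle x z1 z2; rewrite -/D; lra.
have f8 s : 0 <= s -> s <= k * (l1 + D) ->
    k * mdist (f s) z2 <= k * (l1 + D) - s + k * e.
  move=> s0; rewrite mulrDr => sl.
  have [sl1|sl1] := leP s (k * l1).
    have h1 := f5 s s0 sl1; have h2 := metric_triangle (f s) z1 z2; rewrite -/D in h2.
    have : k * mdist (f s) z2 <= k * (mdist (f s) z1 + D) by rewrite ler_wpM2l// ltW.
    by rewrite mulrDr; lra.
  by rewrite f3// -/D; lra.
(* By [f3] the old function already rests at [z1] after time [k * l1]; it is left there for a
   further time [k * D] before the jump to [z2]. *)
exists (fun t => if t <= k * (l1 + D) then f t else z2); split.
- move=> t t0; have [tl|tl] := leP t (k * (l1 + D)); first exact: f1.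
  have : k * mdist x z2 <= k * (l1 + D) by rewrite ler_wpM2l// ltW.
  by lra.
- move=> t; have [tl|tl] := leP t (k * (l1 + D)) => //; apply: (le_trans (f2 t)).
  by rewrite lerDl.
- by move=> t; rewrite ltNge => /negbTE ->.
- move=> s t s0 st; have [tl|tl] := leP t (k * (l1 + D)).
    by rewrite (le_trans st tl); exact: f4.
  have [sl|sl] := leP s (k * (l1 + D)); first by have := f8 s s0 sl; lra.
  by rewrite mdistxx mulr0 addr_ge0 ?subr_ge0.
split.
- by move=> s s0 sl; rewrite sl; exact: f8.
- move=> h.
  rewrite (_ : _ \o _ = fun t => if t <= k * (l1 + D) then h (f t) else h z2); last first.
    by apply/funext => t /=; case: ifP.
  apply: measurable_fun_ifT => //; last exact: f6.
  by apply: measurable_fun_ler => //; exact: measurable_id.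
transitivity (\int[leb]_(t in `[0%R, (k * (l1 + D))%R]) (G (f t))%:E)%E.
  by apply: eq_integral => t; rewrite inE /= in_itv /= => /andP[_ ->].
have mGf : measurable_fun setT (fun t => (G (f t))%:E) by apply/measurable_EFinP; exact: f6.
rewrite (@ge0_integral_itvcc _ _ 0 (k * l1))//; last 3 first.
- by rewrite mulrDr lerDl.
- exact: measurable_funTS.
- by move=> t _; rewrite lee_fin.
have -> : (\int[leb]_(t in `](k * l1)%R, (k * (l1 + D))%R]) (G (f t))%:E =
    \int[leb]_(t in `](k * l1)%R, (k * (l1 + D))%R]) (G z1)%:E)%E.
  by apply: eq_integral => t; rewrite inE /= in_itv /= => /andP[lt _]; rewrite f3.
rewrite f7 integral_cst//.
have mE : leb `](k * l1)%R, (k * (l1 + D))%R]%classic = (k * D)%:E.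
  rewrite lebesgue_itvoc; last by rewrite mulrDr lerDl.
  by congr _%:E; ring.
transitivity ((k * c1)%:E + (G z1)%:E * (k * D)%:E)%E.
  by congr (_ + _ * _)%E; exact: mE.
by rewrite -EFinM -EFinD; congr _%:E; ring.
Qed.

End ChainFunctions.

(** * A lower semicontinuous weight bounded below on a ball *)

Section Weight.
Context {R : realType} {X : pmetricType R}.
Variables (p : R) (mu : {outer_measure set X -> \bar R}).
Hypothesis p0 : 0 < p.
Hypothesis borel_cara : <<s @open X >> `<=` mu.-caratheodory.
Local Open Scope ereal_scope.

Let pN0 : p != 0%R. Proof. by rewrite gt_eqF. Qed.
Let pV0 : (0 <= p^-1)%R. Proof. by rewrite invr_ge0 ltW. Qed.
Let ge0_in (v : \bar R) : 0 <= v -> v \in `[0, +oo].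
Proof. by move=> v0; rewrite in_itv /= v0 leey. Qed.

Let poweRK (v : \bar R) : 0 <= v -> (v `^ p) `^ p^-1 = v.
Proof. by move=> v0; rewrite -poweRrM mulfV// poweRe1. Qed.

Let poweRVK (v : \bar R) : 0 <= v -> (v `^ p^-1) `^ p = v.
Proof. by move=> v0; rewrite -poweRrM mulVf// poweRe1. Qed.

(** This is [lsc_majorant] for the p-th power of [rho], with [theta = c^p], followed by the p-th
    root, which is increasing and so preserves the lower bounds and lower semicontinuity. *)
Lemma lsc_weight (B : set X) (rho : X -> \bar R) (c : R) :
  open B -> 0 < mu B -> mu B < +oo -> (0 < c)%R ->
  measurable_fun setT (rho : g_sigma_algebraType (@open X) -> \bar R) ->
  (forall x, 0 <= rho x) ->
  exists g : X -> \bar R, [/\ forall x, 0 <= g x,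
    forall a, open [set x | a < g x],
    forall x, B x -> rho x <= g x,
    forall x, B x -> c%:E <= g x &
    \int[cara mu]_x (g x `^ p) <=
      \int[cara mu]_x (rho x `^ p) + (2 * c `^ p)%:E * mu B].
Proof.
move=> oB B0 Boo c0 mrho rho0.
have mrp : measurable_fun setT ((fun x => rho x `^ p) : g_sigma_algebraType (@open X) -> \bar R).
  exact: (measurableT_comp (measurable_poweR _)).
have cp0 : (0 < c `^ p)%R by rewrite powR_gt0.
have [h [h0 hlsc hrho hc hint]] := lsc_majorant borel_cara oB B0 Boo cp0 mrp
  (fun x => poweR_ge0 (rho x) p).
exists (fun x => h x `^ p^-1); split.
- by move=> x; exact: poweR_ge0.
- move=> a; have [a0|a0] := ltP a 0.
    rewrite (_ : [set _ | _] = setT); first exact: openT.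
    by apply/seteqP; split => // x _ /=; rewrite (lt_le_trans a0) ?poweR_ge0.
  rewrite (_ : [set _ | _] = [set x | a `^ p < h x]); first exact: hlsc.
  apply/seteqP; split => x /=; rewrite !ltNge; apply: contra => le.
    by rewrite -[leRHS]poweRK// gt0_ler_poweR ?ge0_in ?poweR_ge0.
  by rewrite -[leLHS]poweRVK// gt0_ler_poweR ?ge0_in ?poweR_ge0// ltW.
- move=> x Bx; rewrite -[leLHS]poweRK//.
  by rewrite gt0_ler_poweR ?ge0_in ?poweR_ge0// hrho.
- move=> x Bx; rewrite -[leLHS]poweRK ?lee_fin ?(ltW c0)//.
  by rewrite gt0_ler_poweR ?ge0_in ?poweR_ge0//; rewrite poweR_EFin hc.
under eq_integral do rewrite poweRVK//.
apply: (le_trans hint); rewrite leeD2r//; apply: ge0_subset_integral => //.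
- exact: (open_cara borel_cara oB).
- exact: (borel_measurable_fun borel_cara).
- by move=> x _; exact: poweR_ge0.
Qed.

End Weight.

(** * Limits of chains of bounded cost *)

Section ChainLimit.
Context {R : realType} {X : pmetricType R}.
Notation leb := (@lebesgue_measure R).

(** A chain of length [l], run over [0, 1] in time proportional to length, has weight integral cost
    / l, at most [A / mdist x y] because [l >= mdist x y]. Passing to arc length on the limit curve
    costs its Lipschitz constant [A / c]. The product is of the order of [A] when [A / c] is
    comparable to d(x, y). *)
Lemma limit_of_chains (g : X -> \bar R) (x y : X) (c A K : R) :
  (forall z, (0 <= g z)%E) -> (forall a, open [set z | (a < g z)%E]) ->
  0 < c -> 0 < A -> A / c < K -> (forall z, ball x K z -> (c%:E <= g z)%E) ->
  compact [set z | mdist x z <= A / c] -> x != y ->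
  (forall e, 0 < e -> exists l b, chain e (envelope g e) x y l b /\ b <= A) ->
  exists gamma : R -> X, [/\ gamma 0 = x, gamma 1 = y,
    forall s t, 0 <= s <= 1 -> 0 <= t <= 1 ->
      mdist (gamma s) (gamma t) <= A / c * `|s - t|,
    forall t, 0 <= t <= 1 -> mdist x (gamma t) <= A / c &
    forall T, 0 <= T <= 1 -> (line_integral gamma 0 T g <=
      (A / c * (A / mdist x y))%:E)%E].
Proof.
move=> g0 glsc c0 A0 AK gc cptK xy chains.
pose L := A / c; have L0 : 0 < L by rewrite divr_gt0.
set D := mdist x y; have D0 : 0 < D by rewrite mdist_gt0.
rewrite -/L in AK cptK *.
(* The shift by [n0] makes every scale [e n] small enough that truncation does not cut the lower
   bound [c] and that [L + e n] stays within [K]. *)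
pose n0 := Num.bound (c + (K - L)^-1).
pose e n : R := (n + n0).+1%:R^-1.
have e0 n : 0 < e n by rewrite invr_gt0.
have eb n : c + (K - L)^-1 <= (n + n0).+1%:R.
  apply: (@le_trans _ _ n0%:R); last by rewrite ler_nat ltnW// ltnS leq_addl.
  by rewrite ltW// archi_boundP// addr_ge0 ?invr_ge0 ?subr_ge0// ltW.
have KL : 0 < K - L by rewrite subr_gt0.
have ec n : c <= (e n)^-1.
  by rewrite invrK (le_trans _ (eb n))// lerDl invr_ge0 ltW.
have eK n : L + e n <= K.
  rewrite -lerBrDl invf_ple ?posrE//.
  by rewrite (le_trans _ (eb n))// lerDr ltW.
have G0 n z : 0 <= envelope g (e n) z by exact: envelope_ge0.
have Gc n z : mdist x z <= K - e n -> c <= envelope g (e n) z.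
  move=> xz; apply: le_envelope => // w; rewrite ballEmdist /= => zw; apply: gc.
  by rewrite ballEmdist /=; have := metric_triangle x z w; lra.
have /choice[f hf] : forall n, exists f : R -> X, [/\ f 0 = x,
    mdist (f 1) y <= e n,
    forall t, mdist x (f t) <= L,
    forall s t, 0 <= s <= 1 -> 0 <= t <= 1 -> mdist (f s) (f t) <= L * `|s - t| + e n &
    (forall h : X -> R, measurable_fun setT (h \o f)) /\
    (\int[leb]_(t in `[0%R, 1%R]) (envelope g (e n) (f t))%:E <= (A / D)%:E)%E].
  move=> n; have [l [b [ch bA]]] := chains _ (e0 n).
  have cl := chain_length (G0 n) c0 (eK n) (Gc n) ch bA.
  have Dl : D <= l := chain_dist ch.
  have l0 : 0 < l by exact: lt_le_trans Dl.
  have lL : l <= L by rewrite /L ler_pdivlMr// mulrC (le_trans cl).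
  have k0 : 0 < l^-1 by rewrite invr_gt0.
  have [f [f1 f2 f3 f4 [_ f5 f6]]] := chain_step_function (e0 n) k0 (G0 n) ch.
  rewrite mulVf ?gt_eqF// in f3 f6.
  have lip s t : 0 <= s -> s <= t -> mdist (f s) (f t) <= l * (t - s) + e n.
    move=> s0 st; have h := f4 s t s0 st.
    have {h} : l * (l^-1 * mdist (f s) (f t)) <= l * (t - s + l^-1 * e n) by rewrite ler_pM2l.
    by rewrite mulrDr !mulVKf// gt_eqF.
  exists f; split.
  - apply: mdist_positivity; apply/eqP; rewrite eq_le mdist_ge0 andbT metric_sym.
    by have := f1 0 (lexx _); rewrite pmulr_rle0.
  (* The step function is known to equal [y] only after time 1, so [f 1] is compared with its value
     at [1 + d / l]. *)
  - apply/ler_addgt0Pr => d d0.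
    have dl0 : 0 < d / l by rewrite divr_gt0.
    have le1 : 1 <= 1 + d / l by rewrite lerDl ltW.
    have := lip 1 (1 + d / l) ler01 le1; rewrite (f3 (1 + d / l)) ?ltrDl//.
    have -> : l * (1 + d / l - 1) = d by field; rewrite gt_eqF.
    by lra.
  - by move=> t; rewrite (le_trans (f2 t)).
  - move=> s t /andP[s0 s1] /andP[t0 t1].
    have H u v : 0 <= u -> u <= v -> mdist (f u) (f v) <= L * `|u - v| + e n.
      move=> u0 uv; apply: (le_trans (lip u v u0 uv)).
      by rewrite lerD2r distrC ger0_norm ?subr_ge0// ler_wpM2r// subr_ge0.
    have [st|ts] := leP s t; first exact: H.
    by rewrite metric_sym distrC; apply: H => //; exact: ltW.
  - split => //; rewrite f6 lee_fin mulrC; apply: ler_pM => //.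
    + exact: (chain_ge0 (G0 n) ch).2.
    + by rewrite invr_ge0 ltW.
    + by rewrite lef_pV2 ?posrE.
have esmall eta : 0 < eta -> exists m, forall n, (m <= n)%N -> e n < eta.
  move=> eta0; exists (Num.bound eta^-1) => n mn.
  rewrite invf_plt ?posrE//; apply: (@lt_le_trans _ _ (Num.bound eta^-1)%:R).
    by rewrite archi_boundP// invr_ge0 ltW.
  by rewrite ler_nat ltnW// ltnS (leq_trans mn)// leq_addr.
have [|||||gamma glip gunif] := @asymptotically_lip_limit _ _ _ f L e cptK.
- by move=> n t; case: (hf n) => _ _ + _ _; exact.
- exact: ltW.
- by move=> n; exact: ltW.
- by move=> eta /esmall[m hm]; exists m.
- by move=> n; case: (hf n) => _ _ _ + _; exact.
have gclose t z : 0 <= t <= 1 -> (forall n, mdist (f n t) z <= e n) -> gamma t = z.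
  move=> t01 h; apply: mdist_positivity; apply/eqP; rewrite eq_le mdist_ge0 andbT.
  apply/ler_addgt0Pr => eta eta0; rewrite add0r.
  have eta2 : 0 < eta / 2 by rewrite divr_gt0.
  have [m hm] := esmall _ eta2; have [n mn hn] := gunif _ m eta2.
  have := metric_triangle (gamma t) (f n t) z; rewrite (metric_sym (gamma t) (f n t)).
  by have := hn t t01; have := h n; have := hm n mn; lra.
have i0 : 0 <= (0 : R) <= 1 by rewrite lexx ler01.
have i1 : 0 <= (1 : R) <= 1 by rewrite lexx ler01.
exists gamma; split.
- by apply: gclose => // n; case: (hf n) => -> _ _ _ _; rewrite mdistxx ltW.
- by apply: gclose => // n; case: (hf n).
- exact: glip.
- move=> t t01; apply/ler_addgt0Pr => eta eta0.
  have [n _ hn] := gunif _ 0%N eta0.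
  have := metric_triangle x (f n t) (gamma t); have := hn t t01.
  by case: (hf n) => _ _ /(_ t) + _ _; lra.
move=> T /andP[T0 T1].
have glipT s t : 0 <= s <= T -> 0 <= t <= T ->
    mdist (gamma s) (gamma t) <= L * `|s - t|.
  move=> /andP[s0 sT] /andP[t0 tT].
  by apply: glip; rewrite ?s0 ?t0 /= ?(le_trans sT) ?(le_trans tT).
have rect : rectifiable_curve gamma 0 T by apply: lip_rectifiable glipT => //; exact: ltW.
pose len t := fine (curve_length gamma 0 t).
pose s := arclength_param gamma 0 T.
have lenlip u v : 0 <= u -> u <= v -> v <= T -> 0 <= len v - len u <= L * (v - u).
  move=> u0 uv vT; apply/andP; split.
    exact: le_trans (mdist_ge0 _ _) (arclen_dist rect u0 uv vT).
  rewrite -lee_fin -(curve_length_subE rect)//; apply: lip_curve_length => //.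
    exact: ltW.
  move=> q r /andP[uq qv] /andP[ur rv].
  by apply: glipT; rewrite ?(le_trans u0) /= ?(le_trans qv) ?(le_trans rv).
have menv d : 0 < d ->
    measurable_fun `[0%R, len T] (fun r => (envelope g d (s r))%:E).
  move=> d0; apply: (measurable_arclength_comp rect (rho := EFin \o envelope g d)).
  by apply/measurable_EFinP; apply: usc_borel => a; exact: envelope_usc.
(* For a fixed scale [d], the envelope along [gamma] is dominated by the finer one along a close
   [f n]. Three errors of [d / 3] fit [ball (f n t) (e n)] into the ball of radius [d]: arc length
   against parameter, [f n] against [gamma], and the scale [e n]. *)
have level d : 0 < d -> (\int[leb]_(r in `[0%R, len T]) (envelope g d (s r))%:E <=
    (L * (A / D))%:E)%E.
  move=> d0; have d3 : 0 < d / 3 by rewrite divr_gt0.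
  have [m hm] := esmall _ d3; have [n mn hn] := gunif _ m d3.
  case: (hf n) => _ _ _ _ [f5 f6].
  have mGf : measurable_fun setT (fun t => (envelope g (e n) (f n t))%:E).
    by apply/measurable_EFinP; exact: f5.
  rewrite EFinM; apply: (@le_trans _ _
      (L%:E * \int[leb]_(t in `[0%R, T]) (envelope g (e n) (f n t))%:E)%E); last first.
    rewrite lee_pmul2l ?lte_fin//; apply: le_trans f6.
    apply: ge0_subset_integral => //.
    - exact: measurable_funTS.
    - by move=> r _; rewrite lee_fin.
    - by move=> r /=; rewrite !in_itv /= => /andP[-> /le_trans ->].
  apply: (@integral_reparam_le _ len _ _ T L (d / 3)) => //.
  - by rewrite /len length_xx.
  - exact: menv.
  - exact: measurable_funTS.
  - by move=> r _; rewrite lee_fin envelope_ge0.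
  - by move=> r _; rewrite lee_fin.
  move=> r t hr /andP[t0 tT] rt; rewrite lee_fin.
  have t01 : 0 <= t <= 1 by rewrite t0 (le_trans tT).
  have tT' : 0 <= t <= T by rewrite t0.
  have en := hm n mn; have ftn := hn t t01.
  have lt : 0 <= len t <= len T.
    have /andP[h _] := lenlip t T t0 tT (lexx _); rewrite subr_ge0 in h; rewrite h andbT.
    by rewrite fine_ge0// length_ge0.
  have srt : mdist (s r) (gamma t) <= d / 3.
    rewrite -(arclength_param_len rect tT').
    by apply: (le_trans (arclength_param_lip rect hr lt)).
  apply: envelope_mono => //; first by lra.
  move=> w; rewrite !ballEmdist /= => fw.
  have := metric_triangle (s r) (gamma t) w; have := metric_triangle (gamma t) (f n t) w.
  rewrite (metric_sym (gamma t) (f n t)); lra.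
rewrite /line_integral -/(len T) -/s.
pose G k r := (envelope g k.+1%:R^-1 (s r))%:E.
have kV0 k : 0 < k.+1%:R^-1 :> R by rewrite invr_gt0.
have -> : (\int[leb]_(r in `[0%R, len T]) g (s r) =
    \int[leb]_(r in `[0%R, len T]) limn (G ^~ r))%E.
  by apply: eq_integral => r _; apply/esym/cvg_lim => //; exact: envelope_cvg.
rewrite monotone_convergence//.
- apply: lime_le.
    apply: ereal_nondecreasing_is_cvgn => j k jk; apply: ge0_le_integral => //.
    + by move=> r _; rewrite lee_fin envelope_ge0.
    + exact: menv.
    + exact: menv.
    + move=> r _; rewrite lee_fin; apply: envelope_mono => //.
        by rewrite lef_pV2 ?posrE// ler_nat.
      by apply: le_ball; rewrite lef_pV2 ?posrE// ler_nat.
  by apply: nearW => k; exact: level.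
- by move=> k; exact: menv.
- by move=> k r _; rewrite lee_fin envelope_ge0.
- move=> r _ j k jk; rewrite lee_fin; apply: envelope_mono => //.
    by rewrite lef_pV2 ?posrE// ler_nat.
  by apply: le_ball; rewrite lef_pV2 ?posrE// ler_nat.
Qed.

End ChainLimit.

(** * Curves along which the integral is small *)

Section CurvesOfSmallIntegral.
Context {R : realType} {X : completePMetricType R}.
Variables (Q p : R) (mu : {outer_measure set X -> \bar R}).
Notation cmu := (caratheodory_type mu).
Hypotheses (Q0 : 0 < Q) (Qp : Q < p).
Hypothesis borel_cara : <<s @open X >> `<=` mu.-caratheodory.
Hypothesis ahlfors : ahlfors_regular Q mu.
Hypothesis poincare : poincare_inequality p mu.

Let p0 : 0 < p. Proof. exact: lt_trans Qp. Qed.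
Let a := 1 - Q / p.
Let a0 : 0 < a. Proof. by rewrite subr_gt0 ltr_pdivrMr// mul1r. Qed.

Lemma continuous_bounded_integrable (w : X -> R) (M : R) : continuous w ->
  (forall x, `|w x| <= M) -> integrable_on_balls mu w.
Proof.
move=> cw wM x r r0; have [finb _] := poincare.
apply: measurable_bounded_integrable.
- exact: (open_cara borel_cara (metric_ball_open x r)).
- by case/andP: (finb x r r0).
- apply: measurable_funTS; apply: (borel_measurable_fun borel_cara).
  exact: continuous_borel.
- exists M; split; first exact: num_real.
  by move=> M' MM' z _ /=; rewrite (le_trans (wM z))// ltW.
Qed.

(** The bound is stated for every initial piece of the curve because the decay argument stops the
    curve early. *)
Lemma exists_curve : exists2 C : R, 0 < C &
  forall (rho : X -> \bar R) (N : R) (x y : X),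
    measurable_fun setT (rho : g_sigma_algebraType (@open X) -> \bar R) ->
    (forall z, (0 <= rho z)%E) -> 0 < N ->
    (\int[cara mu]_z (rho z `^ p) <= (N `^ p)%:E)%E -> x != y ->
    exists (gamma : R -> X) (L : R), [/\ gamma 0 = x, gamma 1 = y, 0 < L,
      forall s t, 0 <= s <= 1 -> 0 <= t <= 1 ->
        mdist (gamma s) (gamma t) <= L * `|s - t| &
      forall T, 0 <= T <= 1 -> rectifiable_curve gamma 0 T /\
        (line_integral gamma 0 T rho <= (C * mdist x y `^ a * N)%:E)%E].
Proof.
have [C1 C10 hC1] := morrey Q0 Qp borel_cara ahlfors poincare.
have [B B1 hB] := ahlfors; have B0 : 0 < B by exact: lt_le_trans B1.
have [finb _] := poincare.
pose t2 : R := 2 `^ p^-1; have t20 : 0 < t2 by rewrite powR_gt0.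
pose b2 : R := (2 * B) `^ p^-1; have b20 : 0 < b2 by rewrite powR_gt0// mulr_gt0.
have [C3 C30 C3E] : exists2 C3, 0 < C3 & C3 = 2 * C1 * t2 * b2.
  by exists (2 * C1 * t2 * b2); rewrite // !mulr_gt0.
(* The length bound [A / c] will be [C3 * Lam]^ (Q / p) * D[. As Q / p < 1, it falls below the
   radius]K = Lam * D[once]Lam [^ a] exceeds [C3]. *)
pose Lam := (C3 + 1) `^ a^-1.
have C31 : 0 < C3 + 1 by rewrite addr_gt0.
have Lam0 : 0 < Lam by rewrite powR_gt0.
have LamE : Lam `^ a = C3 + 1.
  by rewrite -powRrM mulVf ?gt_eqF// powRr1// ltW.
have LamS : C3 * Lam `^ (Q / p) < Lam.
  have {2}-> : Lam = Lam `^ a * Lam `^ (Q / p).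
    rewrite -powRD; last by rewrite (gt_eqF Lam0) implybT.
    by rewrite /a subrK powRr1// ltW.
  by rewrite ltr_pM2r ?powR_gt0// LamE ltrDl.
exists (C3 * Lam `^ (Q / p) * (2 * C1 * t2)).
  by rewrite !mulr_gt0// powR_gt0.
move=> rho N x y mrho rho0 N0 rhoN xy.
set D := mdist x y; have D0 : 0 < D by rewrite mdist_gt0.
(* With the weight [c] on [ball x K], a chain of cost at most [A] has length at
   most [A / c < K] and cannot leave that ball. *)
pose K := Lam * D; have K0 : 0 < K by rewrite mulr_gt0.
(* Normalized so that [bK]^ p = 2 * B * K [^ Q]; then [c = N / bK] adds at most [N]^
   p[to the integral, and the norm is at most]2 [^ p^-1 * N]. *)
pose bK := (2 * B) `^ p^-1 * K `^ (Q / p).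
have bK0 : 0 < bK by rewrite mulr_gt0// powR_gt0// mulr_gt0.
pose c := N / bK; have c0 : 0 < c by rewrite divr_gt0.
have [N0' t20' bK0'] : [/\ 0 <= N, 0 <= t2 & 0 <= bK] by split; exact: ltW.
have [D0' Lam0' B0'] : [/\ 0 <= D, 0 <= Lam & 0 <= B] by split; exact: ltW.
have /andP[mK0 mKoo] := finb x K K0.
have [g [g0 glsc grho gc gint]] := lsc_weight p0 borel_cara
  (metric_ball_open x K) mK0 mKoo c0 mrho rho0.
have gN : (\int[cara mu]_z (g z `^ p) <= ((t2 * N) `^ p)%:E)%E.
  apply: (le_trans gint).
  have -> : (t2 * N) `^ p = N `^ p + N `^ p.
    rewrite powRM// -powRrM mulVf ?gt_eqF// powRr1//; ring.
  rewrite EFinD leeD//; have /andP[_ hK] := hB x K K0.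
  apply: (@le_trans _ _ ((2 * c `^ p)%:E * (B * K `^ Q)%:E)%E).
    by rewrite lee_pmul2l// lte_fin mulr_gt0// powR_gt0.
  rewrite -EFinM lee_fin /c powRM ?invr_ge0//.
  have bKp : bK `^ p = 2 * B * K `^ Q.
    rewrite /bK powRM ?powR_ge0// -!powRrM mulVf ?gt_eqF// divfK ?gt_eqF// powRr1//.
    by rewrite mulr_ge0// ltW.
  have -> : bK^-1 `^ p = (bK `^ p)^-1.
    by rewrite -powR_inv1// -powRrM mulN1r powRN.
  rewrite bKp le_eqVlt; apply/orP; left; apply/eqP.
  by field; rewrite !gt_eqF ?powR_gt0.
(* Twice Morrey's bound: the cost at [y], capped at [A], is then strictly below the cap and comes
   from a genuine chain. *)
pose A := 2 * (C1 * D `^ a * (t2 * N)).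
have A00 : 0 < C1 * D `^ a * (t2 * N) by rewrite !mulr_gt0// powR_gt0.
have A0 : 0 < A by rewrite mulr_gt0.
have ALE : A / c = C3 * Lam `^ (Q / p) * D.
  rewrite /A /c C3E /bK -/b2 /K powRM//.
  have DE : D = D `^ a * D `^ (Q / p).
    rewrite -powRD; last by rewrite (gt_eqF D0) implybT.
    by rewrite /a subrK powRr1// ltW.
  rewrite [X in _ = _ * X]DE; field; apply/and4P; split; rewrite gt_eqF// powR_gt0//.
have AK : A / c < K by rewrite ALE /K ltr_pM2r.
have mg := lsc_borel glsc.
have chains e : 0 < e -> exists l b, chain e (envelope g e) x y l b /\ b <= A.
  move=> e0; pose w := chain_cost e (envelope g e) x A.
  have G0 z : 0 <= envelope g e z by exact: envelope_ge0.
  have cw : continuous w.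
    by apply: (chain_cost_continuous e0 G0 (ltW A0) (M := e^-1)) => z; exact: envelope_le_inv.
  have iw : integrable_on_balls mu w.
    apply: (continuous_bounded_integrable (M := A) cw) => z.
    by rewrite ger0_norm ?chain_cost_ge0 ?chain_cost_le// ltW.
  have ug := chain_cost_upper_gradient x g0 e0 (ltW A0) mg.
  have tN0 : 0 <= t2 * N by rewrite mulr_ge0// ltW.
  have := hC1 w g (t2 * N) cw iw ug tN0 gN x y.
  rewrite /w (chain_cost0 _ _ G0 (ltW A0)) sub0r normrN => /(le_trans (ler_norm _)) le.
  have lt : chain_cost e (envelope g e) x A y < A.
    by apply: (le_lt_trans le); rewrite /A -/a -/D; lra.
  have [l [b [ch bA]]] := chain_cost_lt G0 (ltW A0) lt (lexx _).
  by exists l, b; rewrite ltW.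
have cpt := @closed_ball_compact _ _ _ _ borel_cara ahlfors x (A / c).
have [gamma [gx gy glip gball gline]] :=
  limit_of_chains g0 glsc c0 A0 AK gc cpt xy chains.
exists gamma, (A / c); split => //; first by rewrite divr_gt0.
move=> T /andP[T0 T1].
have rect : rectifiable_curve gamma 0 T.
  apply: (@lip_rectifiable _ _ _ _ _ (A / c)) => //; first by rewrite divr_ge0 ?ltW.
  move=> s t /andP[s0 sT] /andP[t0 tT].
  by apply: glip; rewrite ?s0 ?t0 /= ?(le_trans sT) ?(le_trans tT).
split => //; apply: (@le_trans _ _ (line_integral gamma 0 T g)).
  apply: ge0_le_integral => //.
  - exact: (measurable_arclength_comp rect mrho).
  - exact: (measurable_arclength_comp rect mg).
  move=> s; rewrite /= in_itv /= => /(arclength_paramE rect)[t /andP[t0 tT] ->].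
  apply: grho; rewrite ballEmdist /=; apply: le_lt_trans AK.
  by apply: gball; rewrite t0 (le_trans tT).
apply: (le_trans (gline T _)); first by rewrite T0.
rewrite lee_fin ALE /A -/D le_eqVlt; apply/orP; left; apply/eqP.
by field; rewrite gt_eqF.
Qed.

End CurvesOfSmallIntegral.

(** * Growth at infinity *)

Section Decay.
Context {R : realType} {X : completePMetricType R}.
Variables (Q p : R) (mu : {outer_measure set X -> \bar R}) (O : X).
Notation cmu := (caratheodory_type mu).
Hypotheses (Q0 : 0 < Q) (Qp : Q < p).
Hypothesis borel_cara : <<s @open X >> `<=` mu.-caratheodory.
Hypothesis ahlfors : ahlfors_regular Q mu.
Hypothesis poincare : poincare_inequality p mu.

Let p0 : 0 < p. Proof. exact: lt_trans Qp. Qed.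
Let a := 1 - Q / p.
Let a0 : 0 < a. Proof. by rewrite subr_gt0 ltr_pdivrMr// mul1r. Qed.

Variables (u : X -> R) (rho : X -> \bar R).
Hypothesis ug : upper_gradient rho u.
Hypothesis rho_fin : (\int[cara mu]_x (rho x `^ p) < +oo)%E.

Let mball (x : X) r : measurable (ball x r : set cmu).
Proof. exact: (open_cara borel_cara (metric_ball_open x r)). Qed.

Let mrho : measurable_fun setT (rho : g_sigma_algebraType (@open X) -> \bar R).
Proof. by case: ug. Qed.

Let rho0 x : (0 <= rho x)%E. Proof. by case: ug. Qed.

Let mrp : measurable_fun setT ((fun x => rho x `^ p)%E : cmu -> \bar R).
Proof.
apply: (measurableT_comp (measurable_poweR _)).
exact: (borel_measurable_fun borel_cara).
Qed.

Lemma holder_bound : exists2 H : R, 0 < H &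
  forall x y, `|u x - u y| <= H * mdist x y `^ a.
Proof.
have [C C0 hC] := exists_curve Q0 Qp borel_cara ahlfors poincare.
have Ioo := rho_fin; set I := (\int[cara mu]_x (rho x `^ p))%E in Ioo.
have I0 : (0 <= I)%E by apply: integral_ge0 => x _; exact: poweR_ge0.
have IE : I = (fine I)%:E by rewrite fineK// ge0_fin_numE.
have I1 : 0 < fine I + 1 by rewrite ltr_wpDl// fine_ge0.
(* Adding 1 makes [N] positive even when the integral vanishes. *)
pose N := (fine I + 1) `^ p^-1; have N0 : 0 < N by rewrite powR_gt0.
have IN : (I <= (N `^ p)%:E)%E.
  by rewrite IE lee_fin /N -powRrM mulVf ?gt_eqF// powRr1 ?(ltW I1)// lerDl.
exists (C * N); first by rewrite mulr_gt0.
move=> x y; have [->|xy] := eqVneq x y.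
  by rewrite subrr normr0 !mulr_ge0 ?powR_ge0// ltW.
have [gamma [L [gx gy L0 _ hT]]] := hC rho N x y mrho rho0 N0 IN xy.
have [|rect le] := hT 1; first by rewrite ler01 lexx.
case: ug => _ _ /(_ _ _ _ rect); rewrite gx gy => /le_trans/(_ le).
by rewrite lee_fin mulrAC.
Qed.

Lemma tail_small (e : R) : 0 < e -> exists2 r : R, 0 < r &
  (\int[cara mu]_(x in ~` ball O r) (rho x `^ p) <= e%:E)%E.
Proof.
move=> e0.
pose F n := ball O (n.+1%:R : R).
have cv : (\int[cara mu]_(x in F n) (rho x `^ p) @[n --> \oo] -->
    \int[cara mu]_x (rho x `^ p))%E.
  have -> : setT = \bigcup_n F n.
    apply/seteqP; split => // x _; exists (Num.bound (mdist O x)) => //.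
    rewrite /F ballEmdist /=.
    apply: (@lt_le_trans _ _ (Num.bound (mdist O x))%:R); last by rewrite ler_nat.
    by rewrite archi_boundP// mdist_ge0.
  apply: ge0_nondecreasing_set_cvg_integral => //.
  - by apply/nondecreasing_seqP => n; apply/subsetPset; apply: le_ball; rewrite ler_nat.
  - by move=> n; exact: mball.
  - by move=> n; exact: measurable_funTS.
  - by move=> n x _; exact: poweR_ge0.
apply: contrapT => h; move: rho_fin.
set I := (\int[cara mu]_x (rho x `^ p))%E in cv *.
have I0 : (0 <= I)%E by apply: integral_ge0 => x _; exact: poweR_ge0.
move=> Ioo; have IE : I = (fine I)%:E by rewrite fineK// ge0_fin_numE.
have split_ n : I = (\int[cara mu]_(x in F n) (rho x `^ p) +
    \int[cara mu]_(x in ~` F n) (rho x `^ p))%E.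
  rewrite -ge0_integral_setU//.
  - by rewrite setUv.
  - exact: mball.
  - exact/measurableC/mball.
  - by rewrite setUv.
  - by move=> x _; exact: poweR_ge0.
  - by rewrite disj_set2E setICr.
have big n : (e%:E <= \int[cara mu]_(x in ~` F n) (rho x `^ p))%E.
  rewrite leNgt; apply/negP => lt; apply: h; exists n.+1%:R => //; exact: ltW.
have : (I <= I - e%:E)%E.
  rewrite -[leLHS](cvg_lim (@ereal_hausdorff R) cv).
  apply: lime_le; first by apply/cvg_ex; exists I.
  apply: nearW => n; rewrite leeBrDr// [leRHS](split_ n) leeD2l//.
by rewrite IE -EFinB lee_fin; lra.
Qed.

(** Taking [N = e / C] turns the curve estimate into exactly [e * |x|^a]; the rest of [u x] is a
    value of [u] at distance at most [r] from [O], bounded by Hoelder continuity. *)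
Lemma growth_bound (e : R) : 0 < e -> exists M r : R, forall x, r < mdist O x ->
  `|u x| <= M + e * mdist O x `^ a.
Proof.
move=> e0.
have [C C0 hC] := exists_curve Q0 Qp borel_cara ahlfors poincare.
have [H H0 hH] := holder_bound.
pose N := e / C; have N0 : 0 < N by rewrite divr_gt0.
have Np0 : 0 < N `^ p by rewrite powR_gt0.
have [r r0 tail] := tail_small Np0.
exists (`|u O| + H * r `^ a), r => x rx.
have xO : x != O.
  by apply/eqP => xO; move: rx; rewrite xO mdistxx ltNge ltW.
pose rho2 := rho \_ (~` ball O r).
have rho20 z : (0 <= rho2 z)%E by rewrite /rho2 /patch; case: ifP.
have mB : measurable (~` ball O r : set (g_sigma_algebraType (@open X))).
  by apply: measurableC; apply: sub_sigma_algebra; exact: metric_ball_open.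
have mrho2 : measurable_fun setT (rho2 : g_sigma_algebraType (@open X) -> \bar R).
  apply/(measurable_restrictT _ _).1 => //; exact: measurable_funTS.
have int2 : (\int[cara mu]_z (rho2 z `^ p) <= (N `^ p)%:E)%E.
  apply: le_trans tail; rewrite [leRHS]integral_mkcond.
  rewrite le_eqVlt; apply/orP; left; apply/eqP; apply: eq_integral => z _.
  by rewrite /rho2 /patch; case: ifP => // _; rewrite poweR0r// gt_eqF.
have [gamma [L [gx gO L0 lip hT]]] := hC rho2 N x O mrho2 rho20 N0 int2 xO.
(* The curve is stopped at the first time [T] at which it meets the closed ball of
   radius [r]: until then it avoids the open ball, where [rho2] differs from [rho]. *)
pose S := [set t : R | 0 <= t <= 1 /\ mdist O (gamma t) <= r].
have S1 : S 1 by split; rewrite ?ler01 ?lexx// gO mdistxx ltW.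
have Slb : lbound S 0 by move=> t [/andP[]].
have hS : has_inf S by split; [exists 1|exists 0].
pose T := inf S.
have T0 : 0 <= T by apply: lb_le_inf => //; exists 1.
have T1 : T <= 1 by apply: ge_inf => //; exists 0.
have T01 : 0 <= T <= 1 by rewrite T0.
have before t : 0 <= t -> t < T -> r < mdist O (gamma t).
  move=> t0 tT; rewrite ltNge; apply/negP => h.
  have : S t by split => //; rewrite t0 (le_trans (ltW tT)).
  by move=> /(ge_inf hS.2); rewrite leNgt tT.
have atT : mdist O (gamma T) <= r.
  apply/ler_addgt0Pr => d d0.
  have dL0 : 0 < d / L by rewrite divr_gt0.
  have [t [t01 tr] tT] : exists2 t, S t & t < T + d / L.
    by apply: inf_lt hS.1 _; rewrite ltrDl.
  have Tt : T <= t by apply: (ge_inf hS.2); split.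
  have := metric_triangle O (gamma t) (gamma T); have := lip t T t01 T01.
  rewrite ger0_norm ?subr_ge0//.
  have : L * (t - T) <= d by rewrite mulrC -ler_pdivlMr//; lra.
  lra.
(* The endpoint belongs to the stopped curve, so it too must avoid the open ball for [rho2] and
   [rho] to agree at every point of that curve. *)
have atT' : r <= mdist O (gamma T).
  have [T_eq0|TN0] := eqVneq T 0; first by rewrite T_eq0 gx ltW.
  have {}TN0 : 0 < T by rewrite lt_neqAle eq_sym TN0.
  apply/ler_addgt0Pr => d d0.
  pose t := Num.max 0 (T - d / L).
  have dL0 : 0 < d / L by rewrite divr_gt0.
  have t0 : 0 <= t by rewrite le_max lexx.
  have tT : t < T by rewrite gt_max TN0 /=; lra.
  have t01 : 0 <= t <= 1 by rewrite t0 (le_trans (ltW tT)).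
  have := before t t0 tT; have := metric_triangle O (gamma T) (gamma t).
  have := lip T t T01 t01; rewrite ger0_norm; last by rewrite subr_ge0 ltW.
  have tdL : T - d / L <= t by rewrite le_max lexx orbT.
  have : L * (T - t) <= d by rewrite mulrC -ler_pdivlMr//; lra.
  lra.
have outside t : 0 <= t <= T -> rho2 (gamma t) = rho (gamma t).
  move=> /andP[t0]; rewrite le_eqVlt => tT.
  have rt : r <= mdist O (gamma t).
    by case/predU1P : tT => [->//|tT]; rewrite ltW// before.
  rewrite /rho2 /patch mem_set//= ballEmdist /=; apply/negP.
  by rewrite -leNgt.
have [rect le] := hT T T01.
have : (`|u (gamma 0) - u (gamma T)|%:E <= (C * mdist x O `^ a * N)%:E)%E.
  case: ug => _ _ /(_ _ _ _ rect) h; apply: (le_trans h); apply: le_trans le.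
  rewrite le_eqVlt; apply/orP; left; apply/eqP; apply: eq_integral => s.
  rewrite inE /= in_itv /= => /(arclength_paramE rect)[t tT ->].
  by rewrite outside.
rewrite lee_fin gx (metric_sym x O) => h1.
have h2 := hH O (gamma T).
have h3 : H * mdist O (gamma T) `^ a <= H * r `^ a.
  apply: ler_wpM2l; first exact: ltW.
  by apply: ge0_ler_powR; rewrite ?nnegrE ?mdist_ge0//; exact: ltW.
have h4 : C * mdist O x `^ a * N = e * mdist O x `^ a.
  by rewrite /N; field; rewrite gt_eqF.
have := ler_normD (u x - u (gamma T)) (u (gamma T)).
have := ler_normD (u (gamma T) - u O) (u O).
by rewrite !subrK (distrC (u (gamma T))); lra.
Qed.

Lemma mean_growth_bound (e : R) : 0 < e -> exists M r : R, forall x, r < mdist O x ->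
  `|mean mu (ball x 1) u| <= M + e * mdist O x `^ a.
Proof.
move=> e0; have [M [r hM]] := growth_bound e0; have [H H0 hH] := holder_bound.
have [finb _] := poincare.
(* Hoelder continuity makes [u] Borel and bounded on the unit ball, hence integrable there; its mean
   then differs from [u x] by at most [H]. *)
have cu : continuous u.
  move=> x; apply/cvgrPdist_lt => d d0.
  have dH0 : 0 < d / H by rewrite divr_gt0.
  apply/nbhs_ballP; exists ((d / H) `^ a^-1) => /=; first by rewrite powR_gt0.
  move=> y; rewrite ballEmdist /= => xy; apply: (le_lt_trans (hH x y)).
  rewrite mulrC -ltr_pdivlMr//.
  have -> : d / H = ((d / H) `^ a^-1) `^ a.
    by rewrite -powRrM mulVf ?gt_eqF// powRr1// ltW.
  by apply: gt0_ltr_powR; rewrite ?nnegrE ?mdist_ge0 ?powR_ge0.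
exists (M + H), r => x rx.
have near_x y : ball x 1 y -> `|u y - u x| <= H.
  rewrite ballEmdist /= => xy; rewrite distrC; apply: (le_trans (hH x y)).
  rewrite ger_pMr//; apply: (@le_trans _ _ (1 `^ a)); last by rewrite powR1.
  by apply: ge0_ler_powR; rewrite ?nnegrE ?mdist_ge0// ltW.
have h1 : `|mean mu (ball x 1) u - u x| <= H.
  apply: (mean_dist_le _ _ _ near_x); [exact: mball|exact: finb|].
  apply: measurable_bounded_integrable; first exact: mball.
  - by case/andP: (finb x 1 ltr01).
  - apply: measurable_funTS; apply: (borel_measurable_fun borel_cara).
    exact: continuous_borel.
  - exists (`|u x| + H); split; first exact: num_real.
    move=> M' MM' y xy /=; apply: le_trans (ltW MM').
    have := ler_normD (u y - u x) (u x); rewrite subrK.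
    by have := near_x y xy; lra.
have := ler_normD (mean mu (ball x 1) u - u x) (u x); rewrite subrK.
by have := hM x rx; lra.
Qed.

End Decay.

(** [M] may depend on [e]: the hypothesis is used with [e / 2], and the other half absorbs the
    constant once |x|^a exceeds [m / (e / 2)]. *)
Lemma cvg_at_infinity_powR {R : realType} {X : metricType R} (O : X) (F : X -> R) (a : R) :
  0 < a -> (forall e, 0 < e -> exists M r : R, forall x, r < mdist O x ->
    `|F x| <= M + e * mdist O x `^ a) ->
  `|F x| / mdist O x `^ a @[x --> at_infinity O] --> (0 : R).
Proof.
move=> a0 h; apply/cvgrPdist_lt => e e0.
have e2 : 0 < e / 2 by rewrite divr_gt0.
have [M [r hM]] := h _ e2.
pose m := `|M| + 1; have m0 : 0 < m by rewrite ltr_wpDl.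
pose s := (m / (e / 2)) `^ a^-1.
have s0 : 0 < s by rewrite powR_gt0// divr_gt0.
exists (Num.max r s) => x /=; rewrite gt_max => /andP[rx sx].
have x0 : 0 < mdist O x by exact: lt_trans sx.
have xa0 : 0 < mdist O x `^ a by rewrite powR_gt0.
rewrite sub0r normrN ger0_norm ?divr_ge0 ?powR_ge0// ltr_pdivrMr//.
apply: (le_lt_trans (hM x rx)).
have : m < (e / 2) * mdist O x `^ a.
  rewrite mulrC -ltr_pdivrMr//.
  have -> : m / (e / 2) = s `^ a.
    by rewrite /s -powRrM mulVf ?gt_eqF// powRr1// divr_ge0// ltW.
  by apply: gt0_ltr_powR; rewrite ?nnegrE ?ltW.
have := ler_norm M; rewrite /m; lra.
Qed.

Theorem theorem1p6 (R : realType) (Q p : R) (hQ : 1 < Q) (hp : Q < p)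
  (X : completePMetricType R) (O : X) (mu : {outer_measure set X -> \bar R})
  (hX : metric_measure_space mu)
  (hunbounded : unbounded_space X)
  (hAhlfors : ahlfors_regular Q mu)
  (hPoincare : poincare_inequality p mu)
  (hchain : annular_chain_property O)
  (u : X -> R) (hu : dotN1p p mu u) :
  `|u x| / mdist O x `^ (1 - Q / p) @[x --> at_infinity O] --> (0 : R) /\
  `|mean mu (ball x 1) u| / mdist O x `^ (1 - Q / p) @[x --> at_infinity O]
    --> (0 : R).
Proof.
have Q0 : 0 < Q by exact: lt_trans hQ.
have a0 : 0 < 1 - Q / p by rewrite subr_gt0 ltr_pdivrMr ?mul1r// (lt_trans Q0).
have [_ [borel_cara _] _ _] := hX.
have [_ [rho ug rho_fin]] := hu.
split; apply: cvg_at_infinity_powR => // e e0.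
- exact: (growth_bound O Q0 hp borel_cara hAhlfors hPoincare ug rho_fin e0).
- exact: (mean_growth_bound O Q0 hp borel_cara hAhlfors hPoincare ug rho_fin e0).
Qed.
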